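(* Assume (A1)–(A2) and $N\geq 1$ (with $N\ge \max\{1,\|f\|_\infty/2\}$ as in the setting of the scheme). Let $v_n^h$ ($n\ge 0$) and $v^h$ be, respectively, continuous solutions to the semi-discrete policy iteration equations and to the semi-discrete HJB equation described in the context. Then there exists a universal constant $C>0$ such that for all $n\geq 1$, $R\geq 1$ and $t\in[0,T]$, \[ \int_{B_R}\left|v^h_n(t,x)-v^h(t,x)\right|^2\,dx \leq \frac{h}{2^{n+1}} \int_t^T \int_{\mathbb{R}^d}\exp\left[C(1+\|\nabla^h v^h\|_\infty^2)(s-t)/h\right] \left|D^h(v^h_0(s,x)-v^h(s,x))\right|^2\min\left\{1,e^{-|x|+R+1}\right\}\, dx\,ds, \] where $B_R$ is the ball of radius $R$ centered at the origin. In particular, \[ \sup_{t \in [0,T]}\int_{B_R}\left|v^h_n(t,x)-v^h(t,x)\right|^2\,dx \leq C2^{-n}\exp\left[C\exp(CT)/h\right]R^d . \]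
   Context: Let $d,m\ge1$, $T\ge 1$, and let $A\subset\mathbb{R}^m$ be compact. Let $c:[0,T]\times\mathbb{R}^d\times A\to\mathbb{R}$, $f:[0,T]\times\mathbb{R}^d\times A\to\mathbb{R}^d$, $q:\mathbb{R}^d\to\mathbb{R}$. For $(t,x,p)$ let $\alpha(t,x,p)=\operatorname{argmin}_{a\in A}[c(t,x,a)+p\cdot f(t,x,a)]$, assumed to be the unique minimizer, and $H(t,x,p)=\min_{a\in A}[c(t,x,a)+p\cdot f(t,x,a)]$. Assumptions: (A1) $c,f,q$ are uniformly bounded and Lipschitz continuous in all their variables; (A2) $\alpha(\cdot,\cdot,\cdot)$ and a given continuous initial policy $\alpha_0:\mathbb{R}\times\mathbb{R}^d\to A$ are uniformly Lipschitz continuous in all their variables. $\|f\|_\infty=\sup|f|$. For $\varphi:\mathbb{R}^d\to\mathbb{R}$, $h\neq0$ and standard basis vectors $e_i$: $\nabla^h\varphi(x)=\big(\frac{\varphi(x+he_i)-\varphi(x-he_i)}{2h}\big)_{i=1}^d$, $\Delta^h\varphi(x)=\sum_{i=1}^d\frac{\varphi(x+he_i)-2\varphi(x)+\varphi(x-he_i)}{h^2}$, $D^h\varphi(x)=\big(\frac{\varphi(x+he_i)-\varphi(x)}{h}\big)_{i=1}^d$; for functions of $(t,x)$ these act in $x$. Semi-discrete policy iteration: fix $h\in(0,1)$ and $N\ge\max\{1,\|f\|_\infty/2\}$; for $n=0,1,\dots$, $v_n^h$ solves $\partial_t v_n^h+c(t,x,\alpha_n(t,x))+\nabla^h v_n^h\cdot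 f(t,x,\alpha_n(t,x))=-Nh\Delta^h v_n^h$ in $(0,T)\times\mathbb{R}^d$, $v_n^h(T,x)=q(x)$, and then $\alpha_{n+1}(t,x)=\alpha(t,x,\nabla^h v_n^h(t,x))$. The function $v^h$ solves $\partial_t v^h+H(t,x,\nabla^h v^h)=-Nh\Delta^h v^h$ in $(0,T)\times\mathbb{R}^d$, $v^h(T,x)=q(x)$. A constant is universal if it depends only on $d$, $N$ and the constants in (A1)–(A2).
   Formalization: The continuous solutions v_n^h and v^h are additionally assumed bounded on [0,T]×R^d; without this, unbounded Tychonoff-type solutions (e.g. with c=f=q=0) make the estimate false. *)

(* Defs.v *)
From HB Require Import structures.
From mathcomp Require Import all_boot all_order all_algebra.
From mathcomp Require Import all_classical all_reals all_analysis.
Set Implicit Arguments. Unset Strict Implicit. Unset Printing Implicit Defensive.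
Import Order.TTheory GRing.Theory Num.Theory.
Import numFieldNormedType.Exports.
Local Open Scope classical_set_scope.
Local Open Scope ring_scope.

Section Defs.
Variable R : realType.

Definition evec (d : nat) (i : 'I_d) : 'rV[R]_d := delta_mx 0 i.

Definition dotv (k : nat) (p q : 'rV[R]_k) : R := \sum_(i < k) p 0 i * q 0 i.
Definition sqnorm (k : nat) (x : 'rV[R]_k) : R := \sum_(i < k) (x 0 i) ^+ 2.
Definition enorm (k : nat) (x : 'rV[R]_k) : R := Num.sqrt (sqnorm x).

Definition gradh (d : nat) (h : R) (phi : 'rV[R]_d -> R) (x : 'rV[R]_d) : 'rV[R]_d :=
  \row_(i < d) ((phi (x + h *: evec i) - phi (x - h *: evec i)) / (2 * h)).

Definition laph (d : nat) (h : R) (phi : 'rV[R]_d -> R) (x : 'rV[R]_d) : R :=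
  \sum_(i < d) ((phi (x + h *: evec i) - 2 * phi x + phi (x - h *: evec i)) / h ^+ 2).

Definition fwdh (d : nat) (h : R) (phi : 'rV[R]_d -> R) (x : 'rV[R]_d) : 'rV[R]_d :=
  \row_(i < d) ((phi (x + h *: evec i) - phi x) / h).

Definition Ham (d m : nat) (A : set 'rV[R]_m)
  (c : R -> 'rV[R]_d -> 'rV[R]_m -> R) (f : R -> 'rV[R]_d -> 'rV[R]_m -> 'rV[R]_d)
  (t : R) (x p : 'rV[R]_d) : R :=
  inf [set c t x a + dotv p (f t x a) | a in A].

Definition policy (d m : nat) (h : R)
  (alpha : R -> 'rV[R]_d -> 'rV[R]_d -> 'rV[R]_m) (alpha0 : R -> 'rV[R]_d -> 'rV[R]_m)
  (v : nat -> R -> 'rV[R]_d -> R) (n : nat) : R -> 'rV[R]_d -> 'rV[R]_m :=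
  match n with
  | 0 => alpha0
  | n'.+1 => fun t x => alpha t x (gradh h (v n' t) x)
  end.

Definition vcons (d : nat) (y : R) (x : 'rV[R]_d) : 'rV[R]_d.+1 :=
  \row_(i < d.+1) (if unlift ord0 i is Some j then x 0 j else y).

(* Lebesgue integral over R^d of a nonnegative extended-real function, computed as the
   iterated one-dimensional Lebesgue integral (Tonelli). *)
Fixpoint int_Rd (d : nat) : ('rV[R]_d -> \bar R) -> \bar R :=
  match d return ('rV[R]_d -> \bar R) -> \bar R with
  | 0 => fun g => g 0
  | d'.+1 => fun g =>
      (\int[@lebesgue_measure R]_(y in [set: R]) int_Rd (fun x => g (vcons y x)))%E
  end.

Definition ballR (d : nat) (r : R) : set 'rV[R]_d := [set x | enorm x < r].

Definition is_sol (d : nat) (T N h : R) (q : 'rV[R]_d -> R)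
  (F : R -> 'rV[R]_d -> 'rV[R]_d -> R) (w : R -> 'rV[R]_d -> R) : Prop :=
  {within [set p : R * 'rV[R]_d | 0 <= p.1 <= T], continuous (fun p => w p.1 p.2)} /\
  (exists M : R, forall t x, 0 <= t <= T -> `|w t x| <= M) /\
  (forall x, w T x = q x) /\
  (forall t x, 0 < t < T ->
     derivable (fun s => w s x) t 1 /\
     derive1 (fun s => w s x) t + F t x (gradh h (w t) x) = - (N * h) * laph h (w t) x).

Definition lin_term (d m : nat) (c : R -> 'rV[R]_d -> 'rV[R]_m -> R)
  (f : R -> 'rV[R]_d -> 'rV[R]_m -> 'rV[R]_d) (a : R -> 'rV[R]_d -> 'rV[R]_m)
  (t : R) (x p : 'rV[R]_d) : R :=
  c t x (a t x) + dotv p (f t x (a t x)).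

Definition assumption_A1 (d m : nat) (T K L : R) (A : set 'rV[R]_m)
  (c : R -> 'rV[R]_d -> 'rV[R]_m -> R) (f : R -> 'rV[R]_d -> 'rV[R]_m -> 'rV[R]_d)
  (q : 'rV[R]_d -> R) : Prop :=
  (forall t x a, 0 <= t <= T -> A a -> `|c t x a| <= K /\ enorm (f t x a) <= K) /\
  (forall x, `|q x| <= K) /\
  (forall t t' x x' a a', 0 <= t <= T -> 0 <= t' <= T -> A a -> A a' ->
     `|c t x a - c t' x' a'| <= L * (`|t - t'| + enorm (x - x') + enorm (a - a')) /\
     enorm (f t x a - f t' x' a') <= L * (`|t - t'| + enorm (x - x') + enorm (a - a'))) /\
  (forall x x', `|q x - q x'| <= L * enorm (x - x')).

Definition is_argmin (d m : nat) (T : R) (A : set 'rV[R]_m)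
  (c : R -> 'rV[R]_d -> 'rV[R]_m -> R) (f : R -> 'rV[R]_d -> 'rV[R]_m -> 'rV[R]_d)
  (alpha : R -> 'rV[R]_d -> 'rV[R]_d -> 'rV[R]_m) : Prop :=
  forall t x p, 0 <= t <= T ->
    A (alpha t x p) /\
    forall a, A a -> a <> alpha t x p ->
      c t x (alpha t x p) + dotv p (f t x (alpha t x p)) < c t x a + dotv p (f t x a).

Definition assumption_A2 (d m : nat) (T L : R) (A : set 'rV[R]_m)
  (alpha : R -> 'rV[R]_d -> 'rV[R]_d -> 'rV[R]_m) (alpha0 : R -> 'rV[R]_d -> 'rV[R]_m) : Prop :=
  (forall t t' x x' p p', 0 <= t <= T -> 0 <= t' <= T ->
     enorm (alpha t x p - alpha t' x' p') <= L * (`|t - t'| + enorm (x - x') + enorm (p - p'))) /\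
  (forall t x, A (alpha0 t x)) /\
  (forall t t' x x', enorm (alpha0 t x - alpha0 t' x') <= L * (`|t - t'| + enorm (x - x'))).

Definition supgrad (d : nat) (T h : R) (w : R -> 'rV[R]_d -> R) : R :=
  sup [set enorm (gradh h (w p.1) p.2) | p in [set p : R * 'rV[R]_d | 0 <= p.1 <= T]].

End Defs.

(* Main.v *)
Require Import Defs.
From HB Require Import structures.
From mathcomp Require Import all_boot all_order all_algebra.
From mathcomp Require Import all_classical all_reals all_analysis.
From mathcomp Require Import measurable_realfun ring lra.
Import Order.TTheory GRing.Theory Num.Theory.
Import numFieldNormedType.Exports.
Local Open Scope classical_set_scope.
Local Open Scope ring_scope.

(** Let [w_n = v_n - v^h] and [phi x = min 1 (exp (- |x| + R + 1))].  The equations give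
    [dw_n/dt + f(alpha_n) . grad^h w_n + N h Lap^h w_n = - g_n], where [g_n], the loss of
    using the policy [alpha_n] instead of the optimal one, is bounded by
    [L^2 (1 + |grad^h v^h|) |grad^h w_(n-1)|].  Multiplying by [2 w_n phi] and summing by
    parts, the discrete Laplacian produces [N h |D^h w_n|^2]; Young's inequality absorbs the
    transport term, and [g_n] costs a small multiple of [h |D^h w_(n-1)|^2].  Since
    [phi (x +- h e_i) <= 4 phi x], the remaining terms are at most [C (1 + |grad^h v^h|^2) / h]
    times [w_n^2 phi], which the exponential factor compensates.  Hence the weighted
    energies of [D^h w_n] decay geometrically in [n] and dominate the integral of [w_n^2].
    For the second bound, the scheme is monotone because [|f| <= 2 N], so a maximum
    principle bounds [v_0], [v^h] and the differences of [v^h] by exponentials of [T]. *)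

Set Implicit Arguments.
Unset Strict Implicit.

(** The errors [w_n] are only known to be bounded, so everything is integrated against [phi], whose
    integral over [R^d] is at most a constant times the [d]-th power of the radius; this is the
    source of that power in the second bound. All integrals are of nonnegative functions, with
    values in [\bar R]. The summation by parts takes the form of a pointwise identity: [2 w Lap^h w]
    combines squared values at [x], squared values at its neighbours and squared differences.
    Translation invariance then carries the shift from the neighbouring values to the weight. The
    only integral ever cancelled is that of [w^2 phi] with its exponential factor, finite because
    [w] is bounded.

    The Young inequality for the loss is calibrated so that each iteration at least halves the
    energy of the differences, while the remaining numerical factors multiply to exactly
    [h / 2^(n+1)]. In the second bound the differences of [v_0 - v^h] are estimated crudely, at the
    price of negative powers of [h], which the exponential of a multiple of [1 / h] swallows. *)

(** The integral of a nonnegative function is a supremum over the simple functions below it, hence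
    monotone by inclusion. This allows a comparison of integrands that carry the indicator of a
    ball, or that are known to be continuous only for times in [[0, T]]. *)
Lemma ge0_le_integral_nonmeasurable (disp : measure_display) (S : measurableType disp)
    (R : realType) (mu : {measure set S -> \bar R}) (D : set S) (f g : S -> \bar R) :
  (forall x, D x -> (0 <= f x)%E) -> (forall x, D x -> (f x <= g x)%E) ->
  (\int[mu]_(x in D) f x <= \int[mu]_(x in D) g x)%E.
Proof.
move=> f0 fg; rewrite !(integral_mkcond D).
have r0 x : (0 <= (f \_ D) x)%E by apply: erestrict_ge0.
have rg x : ((f \_ D) x <= (g \_ D) x)%E by apply: lee_restrict.
rewrite !ge0_integralTE => [|x|x] //; last exact: le_trans (r0 x) (rg x).
apply: ereal_sup_le => _ [k /= kf <-].
by exists k => //= x; exact: le_trans (kf x) (rg x).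
Qed.

(** * Measurability, Tonelli and translation invariance for the iterated integral over [R^d] *)

Section IntRd.
Variable R : realType.
Notation leb := (@lebesgue_measure R).
Notation mR := (measurableTypeR R).

(* Joint measurability of [g] on [S * R^d], phrased through the [vcons] decomposition of
   [R^d] so that it matches the recursion defining [int_Rd]. *)
Fixpoint rmeas (d : nat) : forall (disp : measure_display) (S : measurableType disp),
    (S -> 'rV[R]_d -> \bar R) -> Prop :=
  match d return forall (disp : measure_display) (S : measurableType disp),
    (S -> 'rV[R]_d -> \bar R) -> Prop with
  | 0 => fun disp S g => measurable_fun [set: S] (fun s => g s 0 : \bar R)
  | d'.+1 => fun disp S g =>
      @rmeas d' _ (S * mR)%type (fun p x => g p.1 (vcons p.2 x))
  end.

Lemma int_Rd_ge0 (d : nat) (g : 'rV[R]_d -> \bar R) :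
  (forall x, (0 <= g x)%E) -> (0 <= int_Rd g)%E.
Proof.
elim: d g => [|d IH] g g0 /=; first exact: g0.
by apply: integral_ge0 => y _; exact: IH.
Qed.

Lemma le_int_Rd (d : nat) (f g : 'rV[R]_d -> \bar R) :
  (forall x, (0 <= f x)%E) -> (forall x, (f x <= g x)%E) -> (int_Rd f <= int_Rd g)%E.
Proof.
elim: d f g => [|d IH] f g f0 fg /=; first exact: fg.
apply: ge0_le_integral_nonmeasurable => y _; first exact: int_Rd_ge0.
exact: IH.
Qed.

Lemma rmeas_comp (d : nat) (disp disp' : measure_display) (S : measurableType disp)
    (S' : measurableType disp') (k : S' -> S) (g : S -> 'rV[R]_d -> \bar R) :
  measurable_fun [set: S'] k -> rmeas g -> rmeas (fun s => g (k s)).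
Proof.
elim: d disp disp' S S' k g => [|d IH] disp disp' S S' k g mk /= mg.
  exact: (measurableT_comp (f := fun s => g s 0) mg mk).
pose kk (p : S' * mR) : S * mR := (k p.1, p.2).
apply: (IH _ _ _ _ kk _ _ mg).
apply: measurable_fun_pair => //.
exact: measurableT_comp.
Qed.

Lemma rmeas_cvg (d : nat) (disp : measure_display) (S : measurableType disp)
    (gn : nat -> S -> 'rV[R]_d -> \bar R) (g : S -> 'rV[R]_d -> \bar R) :
  (forall n, rmeas (gn n)) -> (forall s x, gn n s x @[n --> \oo] --> g s x) -> rmeas g.
Proof.
elim: d disp S gn g => [|d IH] disp S gn g /= mg cg.
  by apply: (emeasurable_fun_cvg (fun n s => gn n s 0)) => // s _; exact: cg.
apply: (IH _ _ (fun n (p : S * mR) x => gn n p.1 (vcons p.2 x))) => //.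
Qed.

(** The induction hypothesis is applied over [S * mR]: it gives joint measurability of the inner
    integral in the parameter and the first coordinate, and Tonelli integrates that coordinate. This
    is why [rmeas] quantifies over the parameter space. *)
Lemma rmeas_int (d : nat) (disp : measure_display) (S : measurableType disp)
    (g : S -> 'rV[R]_d -> \bar R) :
  (forall s x, (0 <= g s x)%E) -> rmeas g ->
  measurable_fun [set: S] (fun s => int_Rd (g s)).
Proof.
elim: d disp S g => [|d IH] disp S g g0 /= mg; first exact: mg.
have := IH _ _ _ _ mg => /(_ (fun p x => g0 p.1 _)) m1.
apply: (measurable_fun_fubini_tonelli_F (m2 := leb)
   (fun p : S * mR => int_Rd (fun x => g p.1 (vcons p.2 x))) m1).
by move=> p; exact: int_Rd_ge0.
Qed.

Lemma rmeas_section (d : nat) (disp : measure_display) (S : measurableType disp)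
    (g : S -> 'rV[R]_d.+1 -> \bar R) (s : S) :
  rmeas g -> rmeas (fun (y : mR) x => g s (vcons y x)).
Proof.
move=> /= mg.
apply: (rmeas_comp (k := fun y : mR => (s, y)) _ mg).
exact: pair1_measurable.
Qed.

(** Stated for a family indexed by [s], so that the induction can move the outer coordinate into the
    parameter. *)
Lemma int_RdD (d : nat) (disp : measure_display) (S : measurableType disp)
    (f g : S -> 'rV[R]_d -> \bar R) (s : S) :
  (forall s x, (0 <= f s x)%E) -> (forall s x, (0 <= g s x)%E) ->
  rmeas f -> rmeas g ->
  int_Rd (fun x => (f s x + g s x)%E) = (int_Rd (f s) + int_Rd (g s))%E.
Proof.
elim: d disp S f g s => [//|d IH] disp S f g s f0 g0 mf mg /=.
rewrite -ge0_integralD //=.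
- apply: eq_integral => y _.
  by rewrite -(IH _ (S * mR)%type (fun p x => f p.1 (vcons p.2 x))
    (fun p x => g p.1 (vcons p.2 x)) (s, y)).
- by move=> y _; exact: int_Rd_ge0.
- by apply: rmeas_int => //; exact: rmeas_section.
- by move=> y _; exact: int_Rd_ge0.
- by apply: rmeas_int => //; exact: rmeas_section.
Qed.

Lemma int_RdZ (d : nat) (disp : measure_display) (S : measurableType disp)
    (f : S -> 'rV[R]_d -> \bar R) (s : S) (k : R) :
  0 <= k -> (forall s x, (0 <= f s x)%E) -> rmeas f ->
  int_Rd (fun x => (k%:E * f s x)%E) = (k%:E * int_Rd (f s))%E.
Proof.
move=> k0; elim: d disp S f s => [//|d IH] disp S f s f0 mf /=.
rewrite -ge0_integralZl_EFin //=.
- apply: eq_integral => y _.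
  by rewrite -(IH _ (S * mR)%type (fun p x => f p.1 (vcons p.2 x)) (s, y)).
- by move=> y _; exact: int_Rd_ge0.
- by apply: rmeas_int => //; exact: rmeas_section.
Qed.

Lemma int_Rd_fubini (d : nat) (disp : measure_display) (S : measurableType disp)
    (nu : {sigma_finite_measure set S -> \bar R}) (D : set S) (f : S -> 'rV[R]_d -> \bar R) :
  measurable D -> (forall s x, (0 <= f s x)%E) -> rmeas f ->
  (\int[nu]_(s in D) int_Rd (f s) = int_Rd (fun x => \int[nu]_(s in D) f s x))%E.
Proof.
move=> mD; elim: d f => [//|d IH] f f0 mf /=.
pose F (p : S * mR) := int_Rd (fun x => f p.1 (vcons p.2 x)).
have F0 p : (0 <= F p)%E by exact: int_Rd_ge0.
have mF : measurable_fun [set: S * mR] F by exact: rmeas_int.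
(* The indicator transfers the restriction to [D] from the domain to the integrand, so that Tonelli
   applies on the whole product. *)
pose G (p : S * mR) := (F p * (\1_D p.1)%:E)%E.
have mG : measurable_fun [set: S * mR] G.
  apply: emeasurable_funM => //; apply/measurable_EFinP.
  exact: (measurableT_comp (f := \1_D : S -> R)).
transitivity (\int[nu]_s \int[leb]_y G (s, y))%E.
  rewrite integral_mkcond; apply: eq_integral => s _.
  rewrite patchE /G /=; case: ifPn => sD.
    by apply: eq_integral => y _; rewrite indicE sD mule1.
  by rewrite integral0_eq // => y _; rewrite indicE (negbTE sD) mule0.
rewrite fubini_tonelli //; last by move=> p; rewrite mule_ge0 // lee_fin.
apply: eq_integral => y _.
rewrite -IH //; last first.
  apply: (rmeas_comp (k := fun s : S => (s, y : mR)) _ mf).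
  exact: pair2_measurable.
rewrite [RHS]integral_mkcond; apply: eq_integral => s _.
by rewrite patchE /G /F /= indicE; case: ifPn => _; rewrite ?mule1 ?mule0.
Qed.

(** The image of Lebesgue measure under a translation agrees with it on half-open intervals, and
    these determine the measure. *)
Lemma lebesgue_shift (z : R) (f : R -> \bar R) :
  (forall y, (0 <= f y)%E) -> measurable_fun [set: mR] f ->
  (\int[leb]_y f (y + z)%R = \int[leb]_y f y)%E.
Proof.
move=> f0 mf.
have mz : measurable_fun [set: mR] (fun y : mR => (y + z : mR)).
  by apply: measurable_funD => //; exact: measurable_cst.
rewrite -[LHS](@ge0_integral_pushforward _ _ mR mR R _ mz leb setT f) //.
apply/esym; apply: eq_measure_integral => A mA _ /=.
apply: lebesgue_measure_unique => // _ [[a b] /= ab <-].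
rewrite /pushforward.
have -> : (fun y => y + z) @^-1` `]a, b] = `]a - z, b - z]%classic.
  by apply/seteqP; split => y /=; rewrite !in_itv /= ltrBlDr lerBrDr.
rewrite !lebesgue_measure_itv /= !lte_fin ltrD2r.
by case: ifP => // _; rewrite -!EFinB opprB addrA subrK.
Qed.

Lemma vconsD (d : nat) (y y' : R) (x x' : 'rV[R]_d) :
  vcons (y + y') (x + x') = vcons y x + vcons y' x'.
Proof. by apply/rowP => i; rewrite !mxE; case: unliftP => [j|] _; rewrite ?mxE. Qed.

Lemma vcons_decomp (d : nat) (z : 'rV[R]_d.+1) :
  z = vcons (z 0 ord0) (\row_j z 0 (lift ord0 j)).
Proof. by apply/rowP => i; rewrite !mxE; case: unliftP => [j ->|->]; rewrite ?mxE. Qed.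

Lemma int_Rd_shift (d : nat) (g : 'rV[R]_d -> \bar R) (z : 'rV[R]_d) :
  (forall x, (0 <= g x)%E) -> rmeas (fun _ : unit => g) ->
  int_Rd (fun x => g (x + z)) = int_Rd g.
Proof.
elim: d g z => [|d IH] g z g0 mg; first by rewrite /= (thinmx0 z) addr0.
rewrite (vcons_decomp z) /=; set z0 := z 0 ord0; set z' := \row__ _.
have mg' := rmeas_section tt mg.
transitivity (\int[leb]_y int_Rd (fun x => g (vcons (y + z0)%R x)))%E.
  apply: eq_integral => y _; rewrite -(IH (fun x => g (vcons (y + z0) x)) z') //; last first.
    apply: (rmeas_comp (k := fun _ : unit => (y + z0 : mR))
      (g := fun (y : mR) x => g (vcons y x)) _ mg').
    exact: measurable_cst.
  by congr int_Rd; apply/funext => x; rewrite vconsD.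
rewrite (@lebesgue_shift z0 (fun y => int_Rd (fun x => g (vcons y x)))) //.
  by move=> y; exact: int_Rd_ge0.
exact: rmeas_int.
Qed.

Lemma vcons0 (d : nat) (y : R) (x : 'rV[R]_d) : vcons y x 0 ord0 = y.
Proof. by rewrite mxE unlift_none. Qed.

Lemma vconsS (d : nat) (y : R) (x : 'rV[R]_d) (j : 'I_d) :
  vcons y x 0 (lift ord0 j) = x 0 j.
Proof. by rewrite mxE liftK. Qed.

Lemma measurable_floor_fiber (c : R) (j : int) :
  measurable ((fun y : mR => Num.floor (c * y)) @^-1` [set j]).
Proof.
have -> : (fun y : mR => Num.floor (c * y)) @^-1` [set j] =
  (fun y : mR => c * y : mR) @^-1` `[j%:~R, (j + 1)%:~R[.
  apply/seteqP; split => y /=; rewrite in_itv /=.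
    by move=> <-; rewrite Num.Theory.floor_le_tmp Num.Theory.floorD1_gt.
  by move=> ?; apply: Num.Theory.floor_def.
have mc : measurable_fun [set: mR] (fun y : mR => c * y : mR).
  by apply: measurable_funM => //; exact: measurable_cst.
rewrite -[X in measurable X]setTI; apply: mc => //.
Qed.

(** [G] may be arbitrary: its arguments take countably many values, each on a measurable set. The
    induction stores the floor of the first coordinate in the key, so [K] becomes [K * int], which
    is still countable. *)
Lemma rmeas_discrete (d : nat) (disp : measure_display) (S : measurableType disp)
    (K : countType) (k : S -> K) (c : R) (G : K -> seq int -> \bar R) :
  (forall i, measurable (k @^-1` [set i])) ->
  rmeas (fun s (x : 'rV[R]_d) => G (k s) [seq Num.floor (c * x 0 j) | j <- enum 'I_d]).
Proof.
elim: d disp S K k G => [|d IH] disp S K k G mk /=.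
  move=> _ A mA; rewrite setTI.
  pose F n := if unpickle n is Some i then
    (if `[< A (G i [::]) >] then k @^-1` [set i] else set0) else set0.
  have -> : (fun s => G (k s) [seq Num.floor (c * (0 : 'rV[R]_0) 0 j) | j <- enum 'I_0])
      @^-1` A = \bigcup_n F n.
    rewrite (size0nil (size_enum_ord 0)) /F; apply/seteqP; split => [s /= As|s [n _]].
      by exists (pickle (k s)) => //; rewrite pickleK asboolT.
    by case: unpickle => // i; case: asboolP => // + /= ->.
  apply: bigcupT_measurable => n; rewrite /F; case: unpickle => // i.
  by case: asboolP.
pose kk (p : S * mR) := (k p.1, Num.floor (c * p.2)).
have mkk : forall i, measurable (kk @^-1` [set i]).
  move=> [i j].
  have -> : kk @^-1` [set (i, j)] = (k @^-1` [set i]) `*` ((fun y : mR => Num.floor (c * y)) @^-1` [set j]).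
    by apply/seteqP; split => -[s y] [/= ks fy]; rewrite /kk /= ?ks ?fy.
  apply: measurableX => //.
  exact: measurable_floor_fiber.
have := IH _ _ (K * int)%type kk (fun i l => G i.1 (i.2 :: l)) mkk.
congr rmeas; apply/funext => -[s y]; apply/funext => x /=.
rewrite enum_ordSl /= vcons0 -map_comp; congr (G _ (_ :: _)).
by apply: eq_map => j /=; rewrite vconsS.
Qed.

Lemma floor_approx_cvg (y : R) :
  (Num.floor (n.+1%:R * y))%:~R / n.+1%:R @[n --> \oo] --> y.
Proof.
apply/cvgrPdist_le => e e0; near=> n.
have c0 : 0 < n.+1%:R :> R by rewrite ltr0n.
have h1 := Num.Theory.floor_le_tmp (n.+1%:R * y).
have h2 := Num.Theory.floorD1_gt (n.+1%:R * y).
rewrite ger0_norm; last first.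
  by rewrite subr_ge0 ler_pdivrMr // (mulrC y).
rewrite lerBlDr -(ler_pM2l c0) mulrDr mulrCA divff ?gt_eqF // mulr1.
apply: (le_trans (ltW h2)); rewrite intrD addrC lerD2r.
rewrite -ler_pdivrMl // mulr1 ltW //.
by near: n; exact: (near_infty_natSinv_lt (PosNum e0)).
Unshelve. all: by end_near. Qed.

(* [g] is the pointwise limit of its values at the lower-left corners of a grid of mesh
   [1 / (n + 1)], which depend on countably many cells only. *)
Lemma rmeas_continuous (d : nat) (g : R -> 'rV[R]_d -> R) :
  continuous (fun p : R * 'rV[R]_d => g p.1 p.2) ->
  rmeas (fun (s : mR) x => (g s x)%:E).
Proof.
move=> cg.
pose sn n (s : R) : R := (Num.floor (n.+1%:R * s))%:~R / n.+1%:R.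
pose xn n (x : 'rV[R]_d) : 'rV[R]_d := \row_j sn n (x 0 j).
apply: (rmeas_cvg (gn := fun n (s : mR) x => (g (sn n s) (xn n x))%:E)) => [n|s x].
  have := @rmeas_discrete d _ mR int (fun s => Num.floor (n.+1%:R * s)) n.+1%:R
    (fun i l => (g (i%:~R / n.+1%:R) (\row_j ((nth 0 l j)%:~R / n.+1%:R)))%:E).
  move=> /(_ (fun j => measurable_floor_fiber _ j)).
  congr rmeas; apply/funext => s; apply/funext => x; congr (g _ _)%:E.
  apply/rowP => j; rewrite !mxE (nth_map j) ?size_enum_ord //.
  by rewrite nth_ord_enum.
apply: cvg_EFin; first by near=> n.
apply: (@cvg_comp _ _ _ (fun n => (sn n s, xn n x))
  (fun p : R * 'rV[R]_d => g p.1 p.2) _ (nbhs (s, x)) _); last exact: (cg (s, x)).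
suff xx : xn n x @[n --> \oo] --> x.
  exact: (cvg_pair (floor_approx_cvg (y := s)) xx).
apply/cvgrPdist_le => e e0.
have H : \forall n \near \oo, forall j : 'I_d, `|x 0 j - sn n (x 0 j)| <= e.
  apply: filter_forall => j.
  by have /cvgrPdist_le := floor_approx_cvg (y := x 0 j); apply.
near=> n.
rewrite /Num.norm /= mx_normrE; apply: bigmax_le; first exact: ltW.
move=> [i j] _; rewrite !mxE ord1 /=.
by move: j; near: n.
Unshelve. all: by end_near. Qed.

End IntRd.

(** * Differential inequalities in time and a comparison principle *)

Section Calculus.
Variable R : realType.
Notation leb := (@lebesgue_measure R).

Lemma derive_ge0_le_endpoints (f df : R -> R) (a b : R) : a <= b ->
  {within `[a, b], continuous f} ->
  (forall s, a < s < b -> is_derive s 1 f (df s)) -> (forall s, a < s < b -> 0 <= df s) ->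
  f a <= f b.
Proof.
move=> ab cf fdf df0; apply: (@ger0_derive1_ndecr R f a b) => // s; rewrite in_itv /= => sab.
  by have [] := fdf s sab.
by rewrite derive1E; have [_ ->] := fdf s sab; exact: df0.
Qed.

(** Only [a - b], which is continuous, gets integrated: with [G] its primitive from [t], the
    function [y - G] has nonnegative derivative, so it is nondecreasing. No integral of [dy] is
    formed. *)
Lemma derive_ge_integral_le (y dy a b : R -> R) (t T : R) : t < T ->
  {within `[t, T], continuous y} -> continuous a -> continuous b ->
  (forall s, t < s < T -> is_derive s 1 y (dy s)) ->
  (forall s, t < s < T -> a s - b s <= dy s) -> y T = 0 ->
  ((y t)%:E + \int[leb]_(s in `[t, T]) (a s)%:E <= \int[leb]_(s in `[t, T]) (b s)%:E)%E.
Proof.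
move=> tT cy ca cb dydy ab yT.
have ci (g : R -> R) : continuous g -> leb.-integrable `[t, T] (EFin \o g).
  move=> cg; apply: continuous_compact_integrable; first exact: segment_compact.
  exact: continuous_subspaceT.
pose g s := a s - b s.
have cg : continuous g by move=> s; apply: cvgB; [exact: ca|exact: cb].
pose G s := (\int[leb]_(u in `[t, s]) g u)%R.
have GE : G T = (\int[leb]_(s in `[t, T]) a s - \int[leb]_(s in `[t, T]) b s)%R.
  by rewrite /G RintegralB //; exact: ci.
have Gt : G t = 0 by rewrite /G set_itv1 Rintegral_set1.
have H : y t - G t <= y T - G T.
  apply: (@derive_ge0_le_endpoints (fun s => y s - G s) (fun s => dy s - g s)).
  - exact: ltW.
  - move=> s; apply: cvgB; first exact: cy.
    by apply: parameterized_integral_continuous; [exact: ltW|exact: ci].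
  - move=> s /[dup] sT /andP[ts sT'].
    have [dG GE'] := @continuous_FTC1_closed R g t s T sT' (ci _ cg) ts (cg s).
    have iG : is_derive s 1 G (g s).
      by apply: DeriveDef => //; rewrite -derive1E.
    have iy := dydy s sT.
    exact: is_deriveB.
  - by move=> s sT; rewrite subr_ge0; exact: ab.
rewrite yT Gt GE subr0 sub0r opprB in H.
rewrite -(fineK (integrable_fin_num _ (ci _ ca))) //.
rewrite -(fineK (integrable_fin_num _ (ci _ cb))) //.
rewrite -EFinD lee_fin.
by rewrite -lerBrDr.
Qed.

(* The supremum of [u] need not be attained.  Writing [Z] for the supremum of
   [u t x * exp (- (b + 1) (T - t))], the inequality integrated in time bounds this quantity
   by [max Q ((kap Z + b Z + a) / (kap + b + 1))], hence [Z <= Q + a]. *)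
Lemma semidiscrete_maximum_principle (X : Type) (T kap a b Q M : R) (u : R -> X -> R) :
  0 <= kap -> 0 <= a -> 0 <= b -> 0 <= Q ->
  (forall t x, 0 <= t <= T -> u t x <= M) ->
  (forall x, {within `[0, T], continuous (u^~ x)}) ->
  (forall x, u T x <= Q) ->
  (forall t x S, 0 < t < T -> 0 <= S -> (forall y, u t y <= S) ->
     exists2 du, is_derive t 1 (u^~ x) du & 0 <= du + kap * (S - u t x) + a + b * S) ->
  forall t x, 0 <= t <= T -> u t x <= (Q + a) * expR ((b + 1) * (T - t)).
Proof.
move=> k0 a0 b0 Q0 uM cu uT ineq t0 x0 t0T.
pose mu := b + 1.
have mu0 : 0 < mu by rewrite /mu; lra.
have T0 : 0 <= T by case/andP: t0T => /le_trans; apply.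
(* The maximum with [0] makes the supremum nonnegative, as [ineq] demands of the bound it
   receives. *)
pose z (p : R * X) := Num.max 0 (u p.1 p.2 * expR (- (mu * (T - p.1)))).
pose E := [set z p | p in [set p : R * X | 0 <= p.1 <= T]].
have Ene : E !=set0 by exists (z (t0, x0)); exists (t0, x0).
have Eub : has_ubound E.
  exists (Num.max 0 M) => _ [[t x] /= tT <-].
  rewrite /z ge_max le_max lexx /= le_max.
  have [|u0] := leP (u t x) 0.
    by move=> u0; rewrite mulr_le0_ge0 ?expR_ge0.
  apply/orP; right; apply: le_trans (uM t x tT).
  rewrite ler_piMr ?(ltW u0) // -expR0 ler_expR oppr_le0 mulr_ge0 ?(ltW mu0) //.
  by case/andP: tT; rewrite subr_ge0.
pose Z := sup E.
have zZ t x : 0 <= t <= T -> z (t, x) <= Z.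
  by move=> tT; apply: ub_le_sup => //; exists (t, x).
have Z0 : 0 <= Z by apply: le_trans (zZ t0 x0 t0T); rewrite /z le_max lexx.
have uZ t x : 0 <= t <= T -> u t x <= Z * expR (mu * (T - t)).
  move=> tT; rewrite -ler_pdivrMr ?expR_gt0 // -expRN.
  by apply: le_trans (zZ t x tT); rewrite /z le_max lexx orbT.
pose r0 := (kap * Z + b * Z + a) / (kap + mu).
have km0 : 0 < kap + mu by rewrite ltr_wpDl.
have r00 : 0 <= r0 by rewrite divr_ge0 ?(ltW km0) // !addr_ge0 ?mulr_ge0.
have main t x : 0 <= t <= T -> u t x * expR (- (mu * (T - t))) <= Num.max r0 Q.
  move=> /andP[tge tle].
  (* Integrating factors: [e1] absorbs the term [- kap * u], and [e2 s] is
     [e1 s * expR (mu * (T - s))], the form taken by the bound on [u] once multiplied by [e1]. The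
     constant [r0] is such that the derivative of [- r0 * e2] covers all that remains, so [y] is
     nondecreasing. *)
  pose e1 s := expR (- (kap * s) - mu * T).
  pose e2 s := expR (- ((kap + mu) * s)).
  pose y s := u s x * e1 s - r0 * e2 s.
  have ye : y t <= y T.
    have /choice [du Hdu] : forall s, exists du, t < s < T ->
        is_derive s 1 (u^~ x) du /\ 0 <= du + kap * (Z * expR (mu * (T - s)) - u s x) + a
          + b * (Z * expR (mu * (T - s))).
      move=> s; have [sT|nsT] := boolP (t < s < T); last by exists 0.
      have sT' : 0 < s < T by case/andP: sT => ts ->; rewrite (le_lt_trans tge ts).
      have [|y'|du d1 d2] := ineq s x (Z * expR (mu * (T - s))) sT'.
      - by rewrite mulr_ge0 ?expR_ge0.
      - by apply: uZ; case/andP: sT' => /ltW -> /ltW ->.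
      by exists du.
    apply: (@derive_ge0_le_endpoints y (fun s => (du s - kap * u s x) * e1 s
       + r0 * (kap + mu) * e2 s)) => //.
    - have cu' : {within `[t, T], continuous (u^~ x)}.
        by apply: continuous_subspaceW (cu x); apply: subset_itvr; rewrite bnd_simp.
      have cexp (p q : R) : {within `[t, T], continuous (fun s : R => expR (p * s + q))}.
        apply: continuous_subspaceT => s; apply: continuous_comp; last exact: continuous_expR.
        apply: cvgD; last exact: cvg_cst.
        by apply: cvgM; [exact: cvg_cst|exact: cvg_id].
      have e1E : e1 = (fun s => expR ((- kap) * s + (- (mu * T)))).
        by apply/funext => s; rewrite /e1 mulNr.
      have e2E : e2 = (fun s => expR ((- (kap + mu)) * s + 0)).
        by apply/funext => s; rewrite /e2 mulNr addr0.
      move=> s; apply: cvgB.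
        by apply: cvgM; [exact: cu'|rewrite e1E; exact: cexp].
      by apply: cvgM; [exact: cvg_cst|rewrite e2E; exact: cexp].
    - move=> s sT; have [d1 _] := Hdu s sT.
      rewrite /y /e1 /e2.
      apply: is_derive_eq.
      rewrite /GRing.scale /=; ring.
    - move=> s sT; have [_ d2] := Hdu s sT.
      have E1 : e1 s * expR (mu * (T - s)) = e2 s.
        by rewrite /e1 /e2 -expRD; congr expR; ring.
      have E12 : e1 s <= e2 s.
        rewrite /e1 /e2 ler_expR.
        suff : mu * s <= mu * T by lra.
        by rewrite ler_pM2l //; case/andP: sT => _ /ltW.
      have r0E : r0 * (kap + mu) = kap * Z + b * Z + a by rewrite /r0 divfK ?gt_eqF.
      have e10 : 0 <= e1 s := expR_ge0 _.
      have : 0 <= (du s + kap * (Z * expR (mu * (T - s)) - u s x) + a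
          + b * (Z * expR (mu * (T - s)))) * e1 s by rewrite mulr_ge0.
      have -> : (du s + kap * (Z * expR (mu * (T - s)) - u s x) + a
          + b * (Z * expR (mu * (T - s)))) * e1 s = (du s - kap * u s x) * e1 s
          + (kap * Z + b * Z) * (e1 s * expR (mu * (T - s))) + a * e1 s by ring.
      rewrite E1 r0E => h; apply: (le_trans h).
      have : a * e1 s <= a * e2 s by rewrite ler_wpM2l.
      lra.
  have e2t : 0 < e2 t by exact: expR_gt0.
  have eqt : u t x * e1 t = u t x * expR (- (mu * (T - t))) * e2 t.
    by rewrite -mulrA -expRD; congr (_ * expR _); ring.
  have eqT : e1 T = e2 T by rewrite /e1 /e2; congr expR; ring.
  have e2T : e2 T <= e2 t by rewrite /e2 ler_expR lerN2 ler_pM2l.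
  have e2T0 : 0 <= e2 T by exact: expR_ge0.
  rewrite -(ler_pM2r e2t) -eqt.
  move: ye; rewrite /y eqT -mulrBl lerBlDr => ye; apply: (le_trans ye).
  have [Qr|rQ] := leP Q r0.
    have : (u T x - r0) * e2 T <= 0.
      by rewrite mulr_le0_ge0 // subr_le0 (le_trans (uT x)).
    lra.
  have : (u T x - r0) * e2 T <= (Q - r0) * e2 T.
    by rewrite ler_wpM2r // lerD2r.
  have : (Q - r0) * e2 T <= (Q - r0) * e2 t.
    by rewrite ler_wpM2l // subr_ge0 ltW.
  lra.
have Zm : Z <= Num.max r0 Q.
  apply: sup_le_ub => // _ [[t x] /= tT <-].
  by rewrite /z ge_max le_max r00 /= main.
have ZQ : Z <= Q + a.
  move: Zm; rewrite le_max => /orP[|]; last by lra.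
  rewrite /r0 ler_pdivlMr // /mu; nra.
apply: (le_trans (uZ t0 x0 t0T)).
by rewrite ler_wpM2r ?expR_ge0.
Qed.

End Calculus.

(** * Euclidean norm, Cauchy-Schwarz and continuity *)

Section Norms.
Variable R : realType.
Notation leb := (@lebesgue_measure R).
Notation mR := (measurableTypeR R).

Lemma sqnorm_ge0 (k : nat) (x : 'rV[R]_k) : 0 <= sqnorm x.
Proof. by apply: sumr_ge0 => i _; exact: sqr_ge0. Qed.

Lemma enorm_ge0 (k : nat) (x : 'rV[R]_k) : 0 <= enorm x.
Proof. exact: sqrtr_ge0. Qed.

Lemma enorm_sqr (k : nat) (x : 'rV[R]_k) : enorm x ^+ 2 = sqnorm x.
Proof. by rewrite sqr_sqrtr ?sqnorm_ge0. Qed.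

Lemma normr_coord_le_enorm (k : nat) (x : 'rV[R]_k) (i : 'I_k) : `|x 0 i| <= enorm x.
Proof.
rewrite -ler_sqr ?nnegrE ?enorm_ge0 // enorm_sqr real_normK ?num_real //.
by rewrite /sqnorm (bigD1 i) //= lerDl sumr_ge0 // => j _; exact: sqr_ge0.
Qed.

Lemma enorm_eq0 (k : nat) (x : 'rV[R]_k) : enorm x = 0 -> x = 0.
Proof.
move=> x0; apply/rowP => i; rewrite mxE; apply/eqP; rewrite -normr_le0 -x0.
exact: normr_coord_le_enorm.
Qed.

(** Cauchy-Schwarz, by expanding the squared norm of [P q - Q p], where [P] and [Q] are the norms of
    [p] and [q]. *)
Lemma dotv_le (k : nat) (p q : 'rV[R]_k) : dotv p q <= enorm p * enorm q.
Proof.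
set P := enorm p; set Q := enorm q.
have P0 : 0 <= P := enorm_ge0 p; have Q0 : 0 <= Q := enorm_ge0 q.
have S : \sum_(i < k) (P * q 0 i - Q * p 0 i) ^+ 2 = 2 * (P * Q) * (P * Q - dotv p q).
  transitivity (P ^+ 2 * sqnorm q + Q ^+ 2 * sqnorm p - 2 * P * Q * dotv p q).
    rewrite /sqnorm /dotv !mulr_sumr -big_split -sumrB /=.
    by apply: eq_bigr => i _; ring.
  by rewrite -!enorm_sqr -/P -/Q; ring.
have [P1|P1] := eqVneq P 0.
  rewrite P1 mul0r /dotv (enorm_eq0 P1) big1 // => i _; by rewrite mxE mul0r.
have [Q1|Q1] := eqVneq Q 0.
  rewrite Q1 mulr0 /dotv (enorm_eq0 Q1) big1 // => i _; by rewrite mxE mulr0.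
have PQ : 0 < 2 * (P * Q) by rewrite !mulr_gt0 // lt0r ?P1 ?Q1.
rewrite -subr_ge0 -(pmulr_rge0 _ PQ) -S.
by apply: sumr_ge0 => i _; exact: sqr_ge0.
Qed.

Lemma enormN (k : nat) (p : 'rV[R]_k) : enorm (- p) = enorm p.
Proof. by rewrite /enorm /sqnorm; congr Num.sqrt; apply: eq_bigr => i _; rewrite mxE sqrrN. Qed.

Lemma normr_dotv_le (k : nat) (p q : 'rV[R]_k) : `|dotv p q| <= enorm p * enorm q.
Proof.
rewrite ler_norml dotv_le andbT lerNl -(enormN p) (le_trans _ (dotv_le _ _)) //.
by rewrite /dotv -sumrN le_eqVlt; apply/orP; left; apply/eqP/eq_bigr => i _; rewrite mxE mulNr.
Qed.

Lemma dotvBr (k : nat) (p q q' : 'rV[R]_k) : dotv p (q - q') = dotv p q - dotv p q'.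
Proof. by rewrite /dotv -sumrB; apply: eq_bigr => i _; rewrite !mxE mulrBr. Qed.

Lemma dotvBl (k : nat) (p q q' : 'rV[R]_k) : dotv (q - q') p = dotv q p - dotv q' p.
Proof. by rewrite /dotv -sumrB; apply: eq_bigr => i _; rewrite !mxE mulrBl. Qed.

Lemma enorm_le_coords (k : nat) (p : 'rV[R]_k) (B : R) :
  (forall i, `|p 0 i| <= B) -> enorm p <= k%:R * B.
Proof.
case: k p => [|k] p pB; first by rewrite /enorm /sqnorm big_ord0 sqrtr0 mul0r.
have B0 : 0 <= B := le_trans (normr_ge0 _) (pB ord0).
rewrite -ler_sqr ?nnegrE ?enorm_ge0 ?mulr_ge0 // enorm_sqr exprMn.
apply: (@le_trans _ _ (\sum_(i < k.+1) B ^+ 2)).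
  apply: ler_sum => i _; rewrite -[X in X <= _]real_normK ?num_real //.
  by rewrite lerXn2r ?nnegrE.
rewrite sumr_const card_ord -[leLHS]mulr_natl ler_wpM2r ?sqr_ge0 //.
by rewrite expr2 ler_peMr // ler1n.
Qed.

Lemma continuous_addr (X : topologicalType) (f g : X -> R) :
  continuous f -> continuous g -> continuous (fun x => f x + g x).
Proof. by move=> cf cg x; apply: cvgD; [exact: cf|exact: cg]. Qed.

Lemma continuous_subr (X : topologicalType) (f g : X -> R) :
  continuous f -> continuous g -> continuous (fun x => f x - g x).
Proof. by move=> cf cg x; apply: cvgB; [exact: cf|exact: cg]. Qed.

Lemma continuous_mulr (X : topologicalType) (f g : X -> R) :
  continuous f -> continuous g -> continuous (fun x => f x * g x).
Proof. by move=> cf cg x; apply: cvgM; [exact: cf|exact: cg]. Qed.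

Lemma continuous_oppr (X : topologicalType) (f : X -> R) :
  continuous f -> continuous (fun x => - f x).
Proof. by move=> cf x; apply: cvgN; exact: cf. Qed.

Lemma continuous_compR (X Y : topologicalType) (f : X -> Y) (g : Y -> R) :
  continuous f -> continuous g -> continuous (fun x => g (f x)).
Proof. by move=> cf cg x; apply: continuous_comp; [exact: cf|exact: cg]. Qed.

Lemma continuous_bigsum (X : topologicalType) (I : Type) (s : seq I) (f : I -> X -> R) :
  (forall i, continuous (f i)) -> continuous (fun x => \sum_(i <- s) f i x).
Proof.
move=> cf; elim: s => [|i s IH] x.
  by under eq_fun do rewrite big_nil; exact: cvg_cst.
under eq_fun do rewrite big_cons.
by apply: cvgD; [exact: cf|exact: IH].
Qed.

Lemma continuous_bigprod (X : topologicalType) (I : Type) (s : seq I) (f : I -> X -> R) :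
  (forall i, continuous (f i)) -> continuous (fun x => \prod_(i <- s) f i x).
Proof.
move=> cf; elim: s => [|i s IH] x.
  by under eq_fun do rewrite big_nil; exact: cvg_cst.
under eq_fun do rewrite big_cons.
by apply: cvgM; [exact: cf|exact: IH].
Qed.

Lemma continuous_minr (X : topologicalType) (f g : X -> R) :
  continuous f -> continuous g -> continuous (fun x => Num.min (f x) (g x)).
Proof. by move=> cf cg x; exact: (@continuous_min R X f g x (cf x) (cg x)). Qed.


Lemma enorm_scale_evec (d : nat) (i : 'I_d) (h : R) : enorm (h *: evec R i) = `|h|.
Proof.
rewrite /enorm /sqnorm (bigD1 i) //= big1 ?addr0.
  by rewrite !mxE !eqxx mulr1 sqrtr_sqr.
by move=> j ji; rewrite !mxE eqxx (negbTE ji) mulr0 expr0n.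
Qed.

Lemma enorm_shift_ge (d : nat) (x : 'rV[R]_d) (i : 'I_d) (c : R) :
  enorm x - `|c| <= enorm (x + c *: evec R i).
Proof.
have [xc|cx] := leP (enorm x) `|c|.
  by apply: le_trans (enorm_ge0 _); rewrite subr_le0.
rewrite -ler_sqr ?nnegrE ?enorm_ge0 ?subr_ge0 ?(ltW cx) //.
have S : sqnorm (x + c *: evec R i) = sqnorm x + 2 * c * x 0 i + c ^+ 2.
  rewrite /sqnorm (bigD1 i) //= [in RHS](bigD1 i) //= !mxE !eqxx mulr1.
  rewrite (eq_bigr (fun j => x 0 j ^+ 2)); first by ring.
  by move=> j ji; rewrite !mxE eqxx (negbTE ji) mulr0 addr0.
rewrite enorm_sqr S -enorm_sqr.
have h1 : `|c * x 0 i| <= `|c| * enorm x.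
  by rewrite normrM ler_wpM2l // normr_coord_le_enorm.
have h2 : `|c| ^+ 2 = c ^+ 2 by rewrite real_normK ?num_real.
move: h1; rewrite ler_norml => /andP[h1 _].
have -> : (enorm x - `|c|) ^+ 2 = enorm x ^+ 2 - 2 * (`|c| * enorm x) + `|c| ^+ 2 by ring.
rewrite h2; lra.
Qed.

Lemma continuous_enorm (d : nat) : continuous (@enorm R d).
Proof.
move=> x; apply: (@continuous_comp _ _ _ (@sqnorm R d)); last exact: sqrt_continuous.
apply: continuous_bigsum => i y.
apply: (@continuous_comp _ _ _ (fun y : 'rV[R]_d => y 0 i) (fun z : R => z ^+ 2)).
  exact: coord_continuous.
exact: exprn_continuous.
Qed.

(** From [1 + x <= exp x] at [x = -1/2] comes [exp (1/2) <= 2], which is then squared. *)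
Lemma expR1_le4 : expR 1 <= 4 :> R.
Proof.
have h : 2^-1 <= expR (- 2^-1) :> R by apply: le_trans (expR_ge1Dx _); lra.
have h2 : expR (2^-1) <= 2 :> R.
  have e := expRxMexpNx_1 (2^-1 : R).
  have e0 : 0 < expR (2^-1) :> R := expR_gt0 _.
  nra.
have -> : 1 = 2^-1 + 2^-1 :> R by field.
rewrite expRD; have e0 : 0 < expR (2^-1) :> R := expR_gt0 _; nra.
Qed.

(** * The exponential weight and its integral *)

Definition weight (d : nat) (r : R) (x : 'rV[R]_d) : R :=
  Num.min 1 (expR (- enorm x + r + 1)).

Lemma weight_gt0 (d : nat) (r : R) (x : 'rV[R]_d) : 0 < weight r x.
Proof. by rewrite /weight lt_min ltr01 expR_gt0. Qed.

Lemma weightE (d : nat) (r : R) (x : 'rV[R]_d) :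
  weight r x = expR (Num.min 0 (- enorm x + r + 1)).
Proof.
rewrite /weight -[X in Num.min X _]expR0.
have [a0|a0] := leP (- enorm x + r + 1) 0.
  by rewrite min_r // ler_expR.
by rewrite min_l // ler_expR ltW.
Qed.

(** The exponent [min 0 (- |x| + r + 1)] is 1-Lipschitz in [x], so a step of length at most [1]
    costs at most a factor [e]. *)
Lemma weight_shift (d : nat) (r : R) (x : 'rV[R]_d) (i : 'I_d) (c : R) :
  `|c| <= 1 -> weight r (x + c *: evec R i) <= 4 * weight r x.
Proof.
move=> c1; have xs := enorm_shift_ge x i c.
apply: (@le_trans _ _ (expR 1 * weight r x)); last first.
  by rewrite ler_wpM2r ?(ltW (weight_gt0 _ _)) // expR1_le4.
rewrite !weightE -expRD ler_expR.
set a := - enorm x + r + 1; set b := - _ + r + 1.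
have ba : b <= a + 1 by rewrite /a /b; lra.
rewrite ge_min; have [a0|a0] := leP a 0.
  by apply/orP; right; lra.
by apply/orP; left; lra.
Qed.

Lemma weight_ball (d : nat) (r : R) (x : 'rV[R]_d) : enorm x < r -> weight r x = 1.
Proof.
move=> xr; rewrite weightE min_l ?expR0 //.
by move: xr; lra.
Qed.

Lemma continuous_weight (d : nat) (r : R) : continuous (@weight d r).
Proof.
apply: (@continuous_minr _ (cst 1) (fun x => expR (- enorm x + r + 1))).
  exact: cst_continuous.
apply: (continuous_compR (f := fun x => - enorm x + r + 1)); last exact: continuous_expR.
apply: continuous_addr; last exact: cst_continuous.
apply: continuous_addr; last exact: cst_continuous.
by apply: continuous_oppr; exact: continuous_enorm.
Qed.

Lemma rmeas_continuous1 (d : nat) (g : 'rV[R]_d -> R) :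
  continuous g -> rmeas (fun _ : unit => fun x => (g x)%:E).
Proof.
move=> cg; apply: (@rmeas_comp R d _ _ mR unit (fun _ => 0 : mR) (fun _ x => (g x)%:E)).
  exact: measurable_cst.
apply: (@rmeas_continuous R d (fun _ => g)) => p.
by apply: continuous_comp; [exact: cvg_snd|exact: cg].
Qed.

Lemma int_Rd_prod_le (d : nat) (psi : R -> R) (k : R) :
  continuous psi -> (forall y, 0 <= psi y) -> 0 <= k ->
  (\int[leb]_y (psi y)%:E <= k%:E)%E ->
  (int_Rd (fun x : 'rV[R]_d => (\prod_(i < d) psi (x 0 i))%:E) <= (k ^+ d)%:E)%E.
Proof.
move=> cpsi p0 k0 kle; elim: d => [|d IH] /=; first by rewrite big_ord0 expr0.
have cprod : continuous (fun x : 'rV[R]_d => \prod_(i < d) psi (x 0 i)).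
  apply: continuous_bigprod => i x.
  by apply: continuous_comp; [exact: coord_continuous|exact: cpsi].
apply: (@le_trans _ _ (\int[leb]_y ((k ^+ d)%:E * (psi y)%:E))%E).
  apply: ge0_le_integral_nonmeasurable => y _.
    by apply: int_Rd_ge0 => x; rewrite lee_fin prodr_ge0.
  rewrite muleC.
  apply: (@le_trans _ _ ((psi y)%:E *
      int_Rd (fun x : 'rV[R]_d => (\prod_(i < d) psi (x 0 i))%:E))%E); last first.
    by apply: lee_wpmul2l => //; rewrite lee_fin.
  rewrite -(int_RdZ (f := fun (_ : unit) (x : 'rV[R]_d) => (\prod_(i < d) psi (x 0 i))%:E) tt) //.
  - apply: le_int_Rd => x; first by rewrite lee_fin prodr_ge0.
    rewrite big_ord_recl vcons0 -EFinM lee_fin.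
    by under eq_bigr do rewrite vconsS.
  - by move=> _ x; rewrite lee_fin prodr_ge0.
  - exact: rmeas_continuous1.
rewrite ge0_integralZl_EFin //.
- by rewrite exprSr EFinM; apply: lee_wpmul2l => //; rewrite lee_fin exprn_ge0.
- by move=> y _; rewrite lee_fin.
- by apply/measurable_EFinP; exact: continuous_measurable_fun.
- exact: exprn_ge0.
Qed.

(** In one variable the interval [[- (r + 1), r + 1]] contributes [2 (r + 1) <= 4 r], and the two
    tails contribute [2 k pi] with [k = 2 d^2]. *)
Definition weight_const (d : nat) : R := 4 + 4 * d%:R ^+ 2 * pi.

Lemma weight_const_ge0 (d : nat) : 0 <= weight_const d.
Proof. by rewrite /weight_const addr_ge0 // !mulr_ge0 // pi_ge0. Qed.

Lemma integral_oneDsqrV_shift (z : R) :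
  (\int[leb]_y ((oneDsqr (y + z)%R)^-1)%:E = pi%:E)%E.
Proof.
rewrite (@lebesgue_shift R z (fun y => ((oneDsqr y)^-1)%:E)).
- rewrite (@ge0_symfun_integralT R (fun y => (oneDsqr y)^-1)).
  + rewrite -set_itvcy integral0y_oneDsqr -EFinM; congr EFin; by field.
  + by move=> x; rewrite invr_ge0 addr_ge0 // sqr_ge0.
  + exact: continuous_oneDsqrV.
  + by move=> x; rewrite /= /oneDsqr sqrrN.
- by move=> x; rewrite lee_fin invr_ge0 addr_ge0 // sqr_ge0.
- by apply/measurable_EFinP; apply: continuous_measurable_fun; exact: continuous_oneDsqrV.
Qed.

(** On the tails, [1 + s^2 / 2 <= exp s] at [s = z / d] gives [exp (- z / d) <= 2 d^2 / (1 + z^2)],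
    a translate of a function whose integral over the line is [pi]. *)
Lemma integral_expR_min_le (d : nat) (r : R) : (0 < d)%N -> 1 <= r ->
  (\int[leb]_y (expR (Num.min 0 (- `|y| + r + 1) / d%:R))%:E <= (weight_const d * r)%:E)%E.
Proof.
move=> d0 r1.
have dR : 1 <= d%:R :> R by rewrite ler1n.
pose q y : R := (oneDsqr y)^-1.
have q0 y : 0 <= q y by rewrite invr_ge0 (le_trans ler01) // oneDsqr_ge1.
pose I : set R := `[- (r + 1), r + 1]%classic.
pose k : R := 2 * d%:R ^+ 2.
have k0 : 0 <= k by rewrite /k mulr_ge0 // exprn_ge0.
have expq z : 0 <= z -> expR (- z / d%:R) <= k * q z.
  move=> z0; rewrite mulNr expRN /q.
  have h : 1 + (z / d%:R) ^+ 2 / 2 <= expR (z / d%:R).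
    by apply: (@expR_ge1Dxn R (z / d%:R) 1); rewrite divr_ge0 // (le_trans ler01).
  have o0 : 0 < oneDsqr z by rewrite (lt_le_trans ltr01) // oneDsqr_ge1.
  rewrite ler_pdivlMr // mulrC ler_pdivrMr ?expR_gt0 //.
  apply: le_trans (_ : k * (1 + (z / d%:R) ^+ 2 / 2) <= _); last by rewrite ler_wpM2l.
  have -> : k * (1 + (z / d%:R) ^+ 2 / 2) = k + z ^+ 2.
    by rewrite /k; field; rewrite gt_eqF // (lt_le_trans ltr01).
  rewrite /oneDsqr lerD2r /k.
  nra.
apply: (@le_trans _ _ (\int[leb]_y ((\1_I y)%:E +
   (k%:E * (q (y + (- (r + 1)))%R)%:E + k%:E * (q (y + (r + 1))%R)%:E)))%E).
  apply: ge0_le_integral_nonmeasurable => y _; first by rewrite lee_fin expR_ge0.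
  rewrite -!EFinM -!EFinD lee_fin.
  have kq z : 0 <= k * q z by rewrite mulr_ge0.
  have [yI|yI] := boolP (y \in I).
    rewrite indicE yI; apply: le_trans (_ : 1 <= _).
      by rewrite -expR0 ler_expR mulr_le0_ge0 ?invr_ge0 // ge_min lexx.
    by rewrite lerDl addr_ge0.
  rewrite indicE (negbTE yI) add0r.
  move: yI; rewrite notin_setE /I /= in_itv /= => /negP; rewrite negb_and -!ltNge => yI.
  have [y0|y0] := leP 0 y.
    have yr : r + 1 < y by case/orP: yI => //; lra.
    apply: le_trans (_ : k * q (y - (r + 1)) <= _); last by rewrite lerDl.
    apply: le_trans (expq _ _); last by lra.
    rewrite ler_expR ler_wpM2r ?invr_ge0 // ?(le_trans ler01) //.
    by rewrite ge_min ger0_norm //; apply/orP; right; lra.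
  have yr : y < - (r + 1) by case/orP: yI => //; lra.
  apply: le_trans (_ : k * q (y + (r + 1)) <= _); last by rewrite lerDr.
  have -> : q (y + (r + 1)) = q (- (y + (r + 1))) by rewrite /q /oneDsqr sqrrN.
  apply: le_trans (expq _ _); last by lra.
  rewrite ler_expR ler_wpM2r ?invr_ge0 // ?(le_trans ler01) //.
  by rewrite ge_min ltr0_norm //; apply/orP; right; lra.
have mq z : measurable_fun [set: mR] (fun y : mR => (q (y + z))%:E).
  apply/measurable_EFinP; apply: continuous_measurable_fun => y.
  apply: (@continuous_comp _ _ _ (fun y : R => y + z) q); last exact: continuous_oneDsqrV.
  by apply: cvgD; [exact: cvg_id|exact: cvg_cst].
have mI : measurable I by exact: measurable_itv.
have q0e z y : (0 <= (q (y + z))%:E)%E by rewrite lee_fin.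
have kq0 z y : (0 <= k%:E * (q (y + z))%:E)%E by rewrite -EFinM lee_fin mulr_ge0.
have mkq z : measurable_fun [set: mR] (fun y : mR => (k%:E * (q (y + z))%:E)%E).
  exact: measurable_funeM.
have mkq2 : measurable_fun [set: mR]
   (fun y : mR => (k%:E * (q (y + (- (r + 1))))%:E + k%:E * (q (y + (r + 1)))%:E)%E).
  exact: emeasurable_funD.
have mI1 : measurable_fun [set: mR] (EFin \o (\1_I : mR -> R)).
  by apply/measurable_EFinP; exact: measurable_indic.
rewrite ge0_integralD //; last by move=> y _; rewrite adde_ge0.
rewrite ge0_integralD // !ge0_integralZl_EFin // !integral_oneDsqrV_shift.
have lI : leb I = (r + 1 - - (r + 1))%:E.
  rewrite lebesgue_measure_itv /= lte_fin ifT ?EFinB //; lra.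
rewrite integral_indic // setIT.
rewrite [X in (X + _)%E](_ : _ = (r + 1 - - (r + 1))%:E) //.
rewrite -!EFinM -!EFinD lee_fin /weight_const /k.
have p0 : 0 <= pi :> R := pi_ge0 _.
have : 4 * d%:R ^+ 2 * pi <= 4 * d%:R ^+ 2 * pi * r.
  by rewrite ler_peMr // !mulr_ge0.
lra.
Qed.

(** The exponent is cut into [d] equal shares and [|x_i| <= |x|] is used in the [i]-th one: the
    weight lies below a product of functions of one coordinate. *)
Lemma int_weight_le (d : nat) (r : R) : (0 < d)%N -> 1 <= r ->
  (int_Rd (fun x : 'rV[R]_d => (weight r x)%:E) <= ((weight_const d * r) ^+ d)%:E)%E.
Proof.
move=> d0 r1.
have dR : 0 < d%:R :> R by rewrite ltr0n.
apply: (@le_trans _ _ (int_Rd (fun x : 'rV[R]_d =>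
  (\prod_(i < d) expR (Num.min 0 (- `|x 0 i| + r + 1) / d%:R))%:E))); last first.
  apply: (@int_Rd_prod_le d (fun y => expR (Num.min 0 (- `|y| + r + 1) / d%:R))).
  - move=> y; apply: continuous_comp; last exact: continuous_expR.
    apply: cvgM; last exact: cvg_cst.
    move: y; apply: continuous_minr => y; first exact: cvg_cst.
    apply: cvgD; last exact: cvg_cst.
    apply: cvgD; last exact: cvg_cst.
    by apply: cvgN; exact: norm_continuous.
  - by move=> y; exact: expR_ge0.
  - by rewrite mulr_ge0 ?weight_const_ge0 // (le_trans ler01).
  - exact: integral_expR_min_le.
apply: le_int_Rd => x; first by rewrite lee_fin ltW // weight_gt0.
rewrite lee_fin weightE -expR_sum ler_expR.
set a := Num.min 0 _.
have -> : a = \sum_(i < d) a / d%:R.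
  by rewrite sumr_const card_ord -[RHS]mulr_natr divfK ?gt_eqF.
apply: ler_sum => i _; rewrite ler_wpM2r ?invr_ge0 ?(ltW dR) //.
rewrite le_min ge_min lexx /= ge_min; apply/orP; right.
by have := normr_coord_le_enorm x i; lra.
Qed.

End Norms.

Lemma continuous_pair (X Y Z : topologicalType) (f : X -> Y) (g : X -> Z) :
  continuous f -> continuous g -> continuous (fun x => (f x, g x)).
Proof. by move=> cf cg x; exact: (cvg_pair (cf x) (cg x)). Qed.

(** * Integrals over a time interval times [R^d] *)

Section SpaceTime.
Variables (R : realType) (d : nat).
Notation leb := (@lebesgue_measure R).
Notation mR := (measurableTypeR R).
Implicit Types g : R -> 'rV[R]_d -> R.

Definition jcont g : Prop := continuous (fun p : R * 'rV[R]_d => g p.1 p.2).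

Lemma jcont_time (e : R -> R) : continuous e -> jcont (fun s _ => e s).
Proof. by move=> ce; apply: (continuous_compR (f := fst)) => // p; exact: cvg_fst. Qed.

Lemma jcont_space (e : 'rV[R]_d -> R) : continuous e -> jcont (fun _ x => e x).
Proof. by move=> ce; apply: (continuous_compR (f := snd)) => // p; exact: cvg_snd. Qed.

Lemma jcont_cst (k : R) : jcont (fun _ _ => k).
Proof. by move=> p; exact: cst_continuous. Qed.

Lemma jcont_shift g (z : 'rV[R]_d) : jcont g -> jcont (fun s x => g s (x + z)).
Proof.
move=> cg; apply: (continuous_compR (f := fun p : R * 'rV[R]_d => (p.1, p.2 + z))
  (g := fun p => g p.1 p.2)) => // p.
apply: continuous_pair p => p; first exact: cvg_fst.
apply: (@cvgD _ _ _ (nbhs p) _ snd (cst z)); first exact: cvg_snd.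
exact: cst_continuous.
Qed.

Lemma jcont_add g g' : jcont g -> jcont g' -> jcont (fun s x => g s x + g' s x).
Proof. exact: continuous_addr. Qed.

Lemma jcont_sub g g' : jcont g -> jcont g' -> jcont (fun s x => g s x - g' s x).
Proof. exact: continuous_subr. Qed.

Lemma jcont_mul g g' : jcont g -> jcont g' -> jcont (fun s x => g s x * g' s x).
Proof. exact: continuous_mulr. Qed.

Lemma jcont_sqr g : jcont g -> jcont (fun s x => g s x ^+ 2).
Proof. by move=> cg; exact: (jcont_mul cg cg). Qed.

Lemma jcont_sum (I : Type) (r : seq I) (g : I -> R -> 'rV[R]_d -> R) :
  (forall i, jcont (g i)) -> jcont (fun s x => \sum_(i <- r) g i s x).
Proof. by move=> cg; apply: continuous_bigsum => i; exact: cg. Qed.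

Variables (t T : R).

Definition stint g : \bar R :=
  (\int[leb]_(s in `[t, T]) int_Rd (fun x => (g s x)%:E))%E.

Lemma jcont_rmeas g : jcont g -> rmeas (fun (s : mR) x => (g s x)%:E).
Proof. exact: rmeas_continuous. Qed.

Lemma stint_ge0 g : (forall s x, 0 <= g s x) -> (0 <= stint g)%E.
Proof. by move=> g0; apply: integral_ge0 => s _; apply: int_Rd_ge0 => x; rewrite lee_fin. Qed.

Lemma le_stint g g' : (forall s x, t <= s <= T -> 0 <= g s x) ->
  (forall s x, t <= s <= T -> g s x <= g' s x) -> (stint g <= stint g')%E.
Proof.
move=> g0 gg'; apply: ge0_le_integral_nonmeasurable => s; rewrite /= in_itv /= => st.
  by apply: int_Rd_ge0 => x; rewrite lee_fin g0.
by apply: le_int_Rd => x; rewrite lee_fin ?g0 ?gg'.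
Qed.

Lemma eq_stint g g' : (forall s x, t <= s <= T -> g s x = g' s x) -> stint g = stint g'.
Proof.
move=> gg'; apply: eq_integral => s; rewrite inE /= in_itv /= => st.
by congr int_Rd; apply/funext => x; rewrite gg'.
Qed.

Lemma measurable_int_jcont g (D : set mR) : jcont g -> (forall s x, 0 <= g s x) ->
  measurable_fun D (fun s : mR => int_Rd (fun x => (g s x)%:E)).
Proof.
move=> cg g0; apply: measurable_funTS.
apply: (rmeas_int (g := fun (s : mR) x => (g s x)%:E)); last exact: jcont_rmeas.
by move=> s x; rewrite lee_fin.
Qed.

Lemma stintD g g' : jcont g -> jcont g' ->
  (forall s x, 0 <= g s x) -> (forall s x, 0 <= g' s x) ->
  stint (fun s x => g s x + g' s x) = (stint g + stint g')%E.
Proof.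
move=> cg cg' g0 g0'; rewrite /stint -ge0_integralD //=.
- apply: eq_integral => s _.
  rewrite -(int_RdD (f := fun (s : mR) x => (g s x)%:E)
    (g := fun (s : mR) x => (g' s x)%:E) s) //.
  + exact: jcont_rmeas.
  + exact: jcont_rmeas.
- by move=> s _; apply: int_Rd_ge0 => x; rewrite lee_fin.
- exact: measurable_int_jcont.
- by move=> s _; apply: int_Rd_ge0 => x; rewrite lee_fin.
- exact: measurable_int_jcont.
Qed.

Lemma stintZ (k : R) g : jcont g -> (forall s x, 0 <= g s x) -> 0 <= k ->
  stint (fun s x => k * g s x) = (k%:E * stint g)%E.
Proof.
move=> cg g0 k0; rewrite /stint -ge0_integralZl_EFin //=.
- apply: eq_integral => s _.
  rewrite -(int_RdZ (f := fun (s : mR) x => (g s x)%:E) s k0) //.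
  + exact: jcont_rmeas.
- by move=> s _; apply: int_Rd_ge0 => x; rewrite lee_fin.
- exact: measurable_int_jcont.
Qed.

Lemma stint_sum (I : Type) (r : seq I) (g : I -> R -> 'rV[R]_d -> R) :
  (forall i, jcont (g i)) -> (forall i s x, 0 <= g i s x) ->
  stint (fun s x => \sum_(i <- r) g i s x) = (\sum_(i <- r) stint (g i))%E.
Proof.
move=> cg g0; elim: r => [|i r IH].
  rewrite big_nil (@eq_stint _ (fun s x => 0 * 0)).
    by rewrite stintZ ?mul0e // => p; exact: cst_continuous.
  by move=> s x _; rewrite big_nil mul0r.
rewrite big_cons -IH -stintD //.
- by apply: eq_stint => s x _; rewrite big_cons.
- exact: jcont_sum.
- by move=> s x; apply: sumr_ge0.
Qed.

Lemma stint_shift g (z : 'rV[R]_d) : jcont g -> (forall s x, 0 <= g s x) ->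
  stint (fun s x => g s (x + z)) = stint g.
Proof.
move=> cg g0; apply: eq_integral => s _.
apply: (int_Rd_shift z (g := fun x => (g s x)%:E)) => [x|]; first by rewrite lee_fin.
apply: rmeas_continuous1.
apply: (continuous_compR (f := fun x => (s, x)) (g := fun p => g p.1 p.2)) => //.
by apply: (@continuous_pair _ _ _ (cst s) id) => x //; exact: cst_continuous.
Qed.

Lemma stint_fubini g : jcont g -> (forall s x, 0 <= g s x) ->
  stint g = int_Rd (fun x => \int[leb]_(s in `[t, T]) (g s x)%:E)%E.
Proof.
move=> cg g0; apply: (@int_Rd_fubini R d _ mR leb _ (fun (s : mR) x => (g s x)%:E)) => //.
exact: jcont_rmeas.
Qed.

Lemma stint_space (e : 'rV[R]_d -> R) : t <= T ->
  stint (fun _ => e) = ((T - t)%:E * int_Rd (fun x => (e x)%:E))%E.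
Proof.
move=> tT; rewrite /stint integral_cst //=; rewrite muleC; congr (_ * _)%E.
rewrite lebesgue_measure_itv /= lte_fin -EFinB.
by case: ltgtP tT => // -> _; rewrite subrr.
Qed.

End SpaceTime.

Lemma ge0_sume_const_ord (R : realType) (n : nat) (x : \bar R) :
  (0 <= x)%E -> (\sum_(i < n) x = n%:R%:E * x)%E.
Proof.
move=> x0; elim: n => [|n IH]; first by rewrite big_ord0 mul0e.
by rewrite big_ord_recr /= IH -natr1 EFinD ge0_muleDl ?lee_fin // mul1e.
Qed.

(** * The weighted energy inequality *)

Section Energy.
Variables (R : realType) (d : nat).
Notation leb := (@lebesgue_measure R).
Notation mR := (measurableTypeR R).
Implicit Types (w u : 'rV[R]_d -> R) (x : 'rV[R]_d).

(** If [p] and [m] are the values at the two neighbours in one direction, [2 w (p - 2 w + m) = p^2 +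
    m^2 - 2 w^2 - (p - w)^2 - (w - m)^2]. Summed over directions, [2 h^2 w Lap^h w] is
    [sqneighbours - sqdiff - 2 d w^2]. *)
Definition sqdiff (h : R) w x : R :=
  \sum_(i < d) ((w (x + h *: evec R i) - w x) ^+ 2 + (w x - w (x - h *: evec R i)) ^+ 2).

Definition sqneighbours (h : R) w x : R :=
  \sum_(i < d) (w (x + h *: evec R i) ^+ 2 + w (x - h *: evec R i) ^+ 2).

Lemma sqdiff_ge0 (h : R) w x : 0 <= sqdiff h w x.
Proof. by apply: sumr_ge0 => i _; rewrite addr_ge0 ?sqr_ge0. Qed.

Lemma sqneighbours_ge0 (h : R) w x : 0 <= sqneighbours h w x.
Proof. by apply: sumr_ge0 => i _; rewrite addr_ge0 ?sqr_ge0. Qed.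

Lemma jcont_sqdiff (h : R) (v : R -> 'rV[R]_d -> R) :
  jcont v -> jcont (fun s x => sqdiff h (v s) x).
Proof.
move=> cv; apply: jcont_sum => i; apply: jcont_add; apply: jcont_sqr.
  by apply: jcont_sub => //; exact: jcont_shift.
by apply: jcont_sub => //; exact: jcont_shift.
Qed.

Lemma jcont_sqneighbours (h : R) (v : R -> 'rV[R]_d -> R) :
  jcont v -> jcont (fun s x => sqneighbours h (v s) x).
Proof.
by move=> cv; apply: jcont_sum => i; apply: jcont_add; apply: jcont_sqr; exact: jcont_shift.
Qed.

Lemma jcont_weight (r : R) : jcont (fun _ (x : 'rV[R]_d) => weight r x).
Proof. by apply: jcont_space; exact: continuous_weight. Qed.

Lemma weight_ge0 (r : R) x : 0 <= weight r x.
Proof. exact/ltW/weight_gt0. Qed.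

(* The shift moves from [g] to the weight, where it costs at most a factor [4]. *)
Lemma stint_shift_weight_le (t T r c : R) (i : 'I_d) (g : R -> 'rV[R]_d -> R) :
  jcont g -> (forall s x, 0 <= g s x) -> `|c| <= 1 ->
  (stint t T (fun s x => (g s (x + c *: evec R i) * weight r x)%R) <=
   4%:E * stint t T (fun s x => (g s x * weight r x)%R))%E.
Proof.
move=> cg g0 c1; set z := c *: evec R i.
have gw0 s x : 0 <= g s x * weight r x by rewrite mulr_ge0 ?weight_ge0.
have jw : jcont (fun s x => g s x * weight r x) := jcont_mul cg (@jcont_weight r).
pose F s (y : 'rV[R]_d) := g s y * weight r (y - z).
have jF : jcont F.
  apply: jcont_mul => //.
  exact: (@jcont_shift R d _ (- z) (@jcont_weight r)).
have F0 s x : 0 <= F s x by rewrite mulr_ge0 ?weight_ge0.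
rewrite (@eq_stint _ _ _ _ _ (fun s x => F s (x + z))); last first.
  by move=> s x _; rewrite /F addrK.
rewrite stint_shift // -stintZ //.
apply: le_stint => s x _ //.
rewrite /F mulrCA ler_wpM2l // /z -scaleNr weight_shift // normrN //.
Qed.

(** There are [2 d] neighbours, and each translation costs the weight a factor [4]. *)
Lemma stint_sqneighbours_le (t T r h : R) (e : R -> R) (v : R -> 'rV[R]_d -> R) :
  0 < h < 1 -> continuous e -> (forall s, 0 <= e s) -> jcont v ->
  (stint t T (fun s x => (e s * sqneighbours h (v s) x * weight r x)%R) <=
   (8 * d%:R)%:E * stint t T (fun s x => (e s * v s x ^+ 2 * weight r x)%R))%E.
Proof.
move=> /andP[h0 h1] ce e0 cv.
have nh : `|h| <= 1 by rewrite gtr0_norm // ltW.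
have nh' : `|- h| <= 1 by rewrite normrN.
pose g s x := e s * v s x ^+ 2.
have cg : jcont g by apply: jcont_mul; [exact: jcont_time|exact: jcont_sqr].
have g0 s x : 0 <= g s x by rewrite mulr_ge0 ?sqr_ge0.
pose G c i s (x : 'rV[R]_d) := g s (x + c *: evec R i) * weight r x.
have cG c i : jcont (G c i) by apply: jcont_mul; [exact: jcont_shift|exact: jcont_weight].
have G0 c i s x : 0 <= G c i s x by rewrite mulr_ge0 ?weight_ge0.
rewrite (@eq_stint _ _ _ _ _ (fun s x => \sum_(i < d) (G h i s x + G (- h) i s x))); last first.
  move=> s x _; rewrite /sqneighbours mulr_sumr mulr_suml; apply: eq_bigr => i _.
  by rewrite /G /g scaleNr; ring.
rewrite stint_sum; last 2 first.
- by move=> i; exact: jcont_add.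
- by move=> i s x; rewrite addr_ge0.
have X0 : (0 <= stint t T (fun s x => (g s x * weight r x)%R))%E.
  by apply: stint_ge0 => s x; rewrite mulr_ge0 ?weight_ge0.
rewrite mulrC EFinM -muleA -ge0_sume_const_ord ?mule_ge0 //.
apply: lee_sum => i _; rewrite stintD //.
have -> : 8%:E = (4%:E + 4%:E)%E :> \bar R by rewrite -EFinD; congr EFin; ring.
by rewrite ge0_muleDl //; apply: leeD; exact: stint_shift_weight_le.
Qed.

(** A backward difference at [x] is the forward one at [x - h e_i]. Forward differences count once
    and the translated ones at most [4] times, whence [5]. *)
Lemma stint_sqdiff_le (t T r h : R) (e : R -> R) (v : R -> 'rV[R]_d -> R) :
  0 < h < 1 -> continuous e -> (forall s, 0 <= e s) -> jcont v ->
  (stint t T (fun s x => (e s * sqdiff h (v s) x * weight r x)%R) <=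
   (5 * h ^+ 2)%:E * stint t T (fun s x => (e s * sqnorm (fwdh h (v s) x) * weight r x)%R))%E.
Proof.
move=> /andP[h0 h1] ce e0 cv.
have nh' : `|- h| <= 1 by rewrite normrN gtr0_norm // ltW.
pose g i s x := e s * (v s (x + h *: evec R i) - v s x) ^+ 2.
have cg i : jcont (g i).
  apply: jcont_mul; first exact: jcont_time.
  by apply: jcont_sqr; apply: jcont_sub => //; exact: jcont_shift.
have g0 i s x : 0 <= g i s x by rewrite mulr_ge0 ?sqr_ge0.
pose G i s x := g i s x * weight r x.
have cG i : jcont (G i) by apply: jcont_mul => //; exact: jcont_weight.
have G0 i s x : 0 <= G i s x by rewrite mulr_ge0 ?weight_ge0.
pose G' i s x := g i s (x + (- h) *: evec R i) * weight r x.
have cG' i : jcont (G' i) by apply: jcont_mul; [exact: jcont_shift|exact: jcont_weight].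
have G0' i s x : 0 <= G' i s x by rewrite mulr_ge0 ?weight_ge0.
rewrite (@eq_stint _ _ _ _ _ (fun s x => \sum_(i < d) (G i s x + G' i s x))); last first.
  move=> s x _; rewrite /sqdiff mulr_sumr mulr_suml; apply: eq_bigr => i _.
  by rewrite /G /G' /g scaleNr subrK; ring.
rewrite stint_sum; last 2 first.
- by move=> i; exact: jcont_add.
- by move=> i s x; rewrite addr_ge0.
have -> : stint t T (fun s x => e s * sqnorm (fwdh h (v s) x) * weight r x) =
    ((h ^- 2)%:E * \sum_(i < d) stint t T (G i))%E.
  rewrite -stint_sum // -stintZ ?invr_ge0 ?sqr_ge0 //; last 2 first.
  - exact: jcont_sum.
  - by move=> s x; apply: sumr_ge0.
  apply: eq_stint => s x _.
  rewrite /sqnorm mulr_sumr mulr_suml mulr_sumr; apply: eq_bigr => i _.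
  by rewrite mxE /G /g; field; rewrite gt_eqF.
rewrite muleA -EFinM mulfK ?gt_eqF ?exprn_gt0 //.
rewrite ge0_sume_distrr; last by move=> i _; exact: stint_ge0.
apply: lee_sum => i _; rewrite stintD //.
have -> : 5%:E = (1%:E + 4%:E)%E :> \bar R by rewrite -EFinD; congr EFin; ring.
rewrite ge0_muleDl ?lee_fin // mul1e; apply: leeD2l.
exact: stint_shift_weight_le.
Qed.

Lemma stint_weight_le (t T r M : R) (g : R -> 'rV[R]_d -> R) :
  (0 < d)%N -> 1 <= r -> t <= T -> 0 <= M -> (forall s x, 0 <= g s x) ->
  (forall s x, t <= s <= T -> g s x <= M) ->
  (stint t T (fun s x => (g s x * weight r x)%R) <=
    (M * (T - t) * (weight_const R d * r) ^+ d)%:E)%E.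
Proof.
move=> d0 r1 tT M0 g0 gM.
apply: (@le_trans _ _ (stint t T (fun s x => (M * weight r x)%R))).
  apply: le_stint => s x st; first by rewrite mulr_ge0 ?weight_ge0.
  by rewrite ler_wpM2r ?weight_ge0 // gM.
rewrite stintZ ?stint_space //; last 2 first.
- exact: jcont_weight.
- by move=> s x; exact: weight_ge0.
rewrite muleA -EFinM [leRHS]EFinM; apply: lee_wpmul2l.
  by rewrite lee_fin mulr_ge0 // subr_ge0.
exact: int_weight_le.
Qed.

(** The hypothesis bounds from below the time derivative of [exp (lam (s - t)) w^2], up to its
    exponential factor. It is integrated in time for each [x], then in space. The summand [8 d w^2]
    is what [stint_sqneighbours_le] charges for [sqneighbours], so the two disappear together, but
    only after integration in space. *)
Lemma energy_inequality (w u : R -> 'rV[R]_d -> R) (t T lam h N M r : R) :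
  (0 < d)%N -> 1 <= r -> t < T -> 0 < h < 1 -> 0 <= N -> 0 <= lam ->
  jcont w -> jcont u -> (forall s x, `|w s x| <= M) -> (forall x, w T x = 0) ->
  (forall s x, t < s < T -> exists2 dw, is_derive s 1 (w^~ x) dw &
     N / h * (3 / 4 * sqdiff h (w s) x - sqneighbours h (w s) x + 8 * d%:R * w s x ^+ 2)
      - sqdiff h (u s) x / (20 * h) <= lam * w s x ^+ 2 + 2 * w s x * dw) ->
  (int_Rd (fun x => (w t x ^+ 2 * weight r x)%:E) +
   (3 / 4 * (N / h))%:E * stint t T (fun s x =>
     (expR (lam * (s - t)) * sqdiff h (w s) x * weight r x)%R) <=
   (1 / (20 * h))%:E * stint t T (fun s x =>
     (expR (lam * (s - t)) * sqdiff h (u s) x * weight r x)%R))%E.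
Proof.
move=> d0 r1 tT h01 N0 lam0 cw cu wM wT ineq.
pose e s := expR (lam * (s - t)).
have /andP[h0 h1] := h01.
have ce : continuous e.
  apply: (continuous_compR (f := fun s => lam * (s - t))); last exact: continuous_expR.
  apply: continuous_mulr; first exact: cst_continuous.
  by apply: continuous_subr; [move=> s; exact: cvg_id|exact: cst_continuous].
have e0 s : 0 <= e s := expR_ge0 _.
have M0 : 0 <= M := le_trans (normr_ge0 _) (wM t 0).
have je := @jcont_time R d e ce.
have jw := @jcont_weight r.
pose W s x := e s * w s x ^+ 2 * weight r x.
pose A s x := e s * sqdiff h (w s) x * weight r x.
pose B s x := e s * sqdiff h (u s) x * weight r x.
pose P s x := e s * sqneighbours h (w s) x * weight r x.
(* Spreading the term at time [t] uniformly over [[t, T]] makes it a space-time integral too, so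
   that one exchange of integrals handles every term. *)
pose k := (T - t)^-1.
have k0 : 0 < k by rewrite invr_gt0 subr_gt0.
pose E0 (s : R) x := w t x ^+ 2 * weight r x.
have jW : jcont W by do 2 ?[apply: jcont_mul => //]; exact: jcont_sqr.
have jA : jcont A by do 2 ?[apply: jcont_mul => //]; exact: jcont_sqdiff.
have jB : jcont B by do 2 ?[apply: jcont_mul => //]; exact: jcont_sqdiff.
have jP : jcont P by do 2 ?[apply: jcont_mul => //]; exact: jcont_sqneighbours.
have jE : jcont E0.
  apply: jcont_mul => //; apply: jcont_sqr.
  apply: (continuous_compR (f := fun p : R * 'rV[R]_d => (t, p.2)) (g := fun p => w p.1 p.2)) => //.
  by apply: continuous_pair; [exact: cst_continuous|move=> p; exact: cvg_snd].
have W0 s x : 0 <= W s x by rewrite mulr_ge0 ?weight_ge0 // mulr_ge0 ?e0 ?sqr_ge0.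
have A0 s x : 0 <= A s x by rewrite mulr_ge0 ?weight_ge0 // mulr_ge0 ?e0 ?sqdiff_ge0.
have B0 s x : 0 <= B s x by rewrite mulr_ge0 ?weight_ge0 // mulr_ge0 ?e0 ?sqdiff_ge0.
have P0 s x : 0 <= P s x by rewrite mulr_ge0 ?weight_ge0 // mulr_ge0 ?e0 ?sqneighbours_ge0.
have E00 s x : 0 <= E0 s x by rewrite mulr_ge0 ?weight_ge0 ?sqr_ge0.
pose c1 := 8 * d%:R * (N / h).
pose c2 := 3 / 4 * (N / h).
pose c3 := N / h.
pose c4 := 1 / (20 * h).
have c30 : 0 <= c3 by rewrite divr_ge0 // ltW.
have c10 : 0 <= c1 by rewrite mulr_ge0.
have c20 : 0 <= c2 by rewrite mulr_ge0.
have c40 : 0 <= c4 by rewrite divr_ge0 // mulr_ge0 // ltW.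
have sec g (x : 'rV[R]_d) : jcont g -> continuous (fun s => g s x).
  move=> jg; apply: (continuous_compR (f := fun s => (s, x)) (g := fun p => g p.1 p.2)) => //.
  by apply: continuous_pair; [move=> s; exact: cvg_id|exact: cst_continuous].
pose a s x := c1 * W s x + c2 * A s x.
pose b s x := c3 * P s x + c4 * B s x.
have ja : jcont a by apply: jcont_add; apply: jcont_mul => //; exact: jcont_cst.
have jb : jcont b by apply: jcont_add; apply: jcont_mul => //; exact: jcont_cst.
have a0 s x : 0 <= a s x by rewrite addr_ge0 // mulr_ge0.
have b0 s x : 0 <= b s x by rewrite addr_ge0 // mulr_ge0.
have pw x : (\int[leb]_(s in `[t, T]) ((k * E0 s x + a s x)%R)%:E <=
    \int[leb]_(s in `[t, T]) (b s x)%:E)%E.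
  have /choice [dw Hdw] : forall s, exists dw, t < s < T -> is_derive s 1 (w^~ x) dw /\
     N / h * (3 / 4 * sqdiff h (w s) x - sqneighbours h (w s) x + 8 * d%:R * w s x ^+ 2)
      - sqdiff h (u s) x / (20 * h) <= lam * w s x ^+ 2 + 2 * w s x * dw.
    move=> s; have [sT|nsT] := boolP (t < s < T); last by exists 0.
    by have [dw ? ?] := ineq s x sT; exists dw.
  have key : ((E0 t x)%:E + \int[leb]_(s in `[t, T]) (a s x)%:E <=
      \int[leb]_(s in `[t, T]) (b s x)%:E)%E.
    have -> : E0 t x = W t x by rewrite /W /e subrr mulr0 expR0 mul1r.
    apply: (@derive_ge_integral_le R (W^~ x)
       (fun s => e s * (lam * w s x ^+ 2 + 2 * w s x * dw s) * weight r x) (a^~ x) (b^~ x)) => //.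
    - by apply: continuous_subspaceT; exact: sec.
    - exact: sec.
    - exact: sec.
    - move=> s sT; have [d1 _] := Hdw s sT.
      rewrite /W /e; apply: is_derive_eq.
      rewrite /GRing.scale /=; ring.
    - move=> s sT; have [_ d2] := Hdw s sT.
      have ew : 0 <= e s * weight r x by rewrite mulr_ge0 ?weight_ge0.
      have -> : a s x - b s x = e s * weight r x * (N / h * (3 / 4 * sqdiff h (w s) x -
          sqneighbours h (w s) x + 8 * d%:R * w s x ^+ 2) - sqdiff h (u s) x / (20 * h)).
        by rewrite /a /b /W /A /P /B /c1 /c2 /c3 /c4; field; rewrite gt_eqF.
      by rewrite [leRHS]mulrAC ler_wpM2l.
    - by rewrite /W wT expr0n /= mulr0 mul0r.
  apply: le_trans key.
  have mc g : jcont g -> measurable_fun `[t, T]%classic (fun s : mR => (g s x)%:E).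
    move=> jg; apply: measurable_funTS; apply/measurable_EFinP.
    by apply: continuous_measurable_fun; exact: sec.
  under eq_integral do rewrite EFinD.
  rewrite ge0_integralD //; last 4 first.
  - by move=> s _; rewrite lee_fin mulr_ge0 // ltW.
  - by apply: (mc (fun s x => k * E0 s x)); apply: jcont_mul => //; exact: jcont_cst.
  - by move=> s _; rewrite lee_fin.
  - exact: mc.
  apply: leeD2r.
  rewrite (integral_cst leb _ (k * E0 t x)%:E) //= lebesgue_measure_itv /= lte_fin tT.
  by rewrite -EFinB -EFinM lee_fin mulrAC mulVf ?mul1r // gt_eqF // subr_gt0.
have tot : (stint t T (fun s x => k * E0 s x + a s x)%R <= stint t T b)%E.
  have jka : jcont (fun s x => k * E0 s x + a s x).
    by apply: jcont_add => //; apply: jcont_mul => //; exact: jcont_cst.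
  have ka0 s x : 0 <= k * E0 s x + a s x by rewrite addr_ge0 // mulr_ge0 // ltW.
  rewrite !stint_fubini //; apply: le_int_Rd => x //.
  by apply: integral_ge0 => s _; rewrite lee_fin.
have jk c g : jcont g -> jcont (fun s x => c * g s x).
  by move=> jg; apply: jcont_mul => //; exact: jcont_cst.
have g0k c g : 0 <= c -> (forall s x, 0 <= g s x) -> forall s (x : 'rV[R]_d), 0 <= c * g s x.
  by move=> ? ? s x; rewrite mulr_ge0.
move: tot; rewrite stintD //; [|exact: jk|exact: g0k (ltW k0) _].
rewrite !stintD //; try exact: jk; try exact: g0k.
rewrite !stintZ // ?(ltW k0) //.
rewrite stint_space ?(ltW tT) // muleA -EFinM mulVf ?gt_eqF ?subr_gt0 // mul1e.
(* Cancelling this integral in [\bar R] requires it to be finite: [w] is bounded and the weight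
   integrable. *)
have Wfin : stint t T W \is a fin_num.
  rewrite ge0_fin_numE; last exact: stint_ge0.
  apply: le_lt_trans (ltry (expR (lam * (T - t)) * M ^+ 2 * (T - t) * (weight_const R d * r) ^+ d)).
  apply: (@stint_weight_le t T r _ (fun s x => e s * w s x ^+ 2)) => //.
  - exact: ltW.
  - by rewrite mulr_ge0 ?expR_ge0 ?sqr_ge0.
  - by move=> s x; rewrite mulr_ge0 ?sqr_ge0.
  move=> s x /andP[ts sT]; apply: ler_pM => //; rewrite ?sqr_ge0 //.
    by rewrite ler_expR ler_wpM2l // lerB.
  by rewrite -[leLHS]real_normK ?num_real // lerXn2r ?nnegrE.
have Ple : (c3%:E * stint t T P <= c1%:E * stint t T W)%E.
  apply: (le_trans (lee_wpmul2l _ (@stint_sqneighbours_le t T r h e w h01 ce e0 cw))).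
    by rewrite lee_fin.
  by rewrite muleA -EFinM mulrC.
move=> tot.
have : (int_Rd (fun x => (E0 t x)%:E) + (c1%:E * stint t T W + c2%:E * stint t T A) <=
   c1%:E * stint t T W + c4%:E * stint t T B)%E.
  by apply: (le_trans tot); exact: leeD2r.
rewrite addeCA leeD2lE // fin_numM //.
Qed.

End Energy.

(** * The difference scheme: extension in time, monotonicity and sup bounds *)

Section Scheme.
Variables (R : realType) (d : nat).
Implicit Types (phi psi : 'rV[R]_d -> R) (x F : 'rV[R]_d).

(* Freezing time outside [0, T] makes a solution continuous on all of [R * R^d]. *)
Definition clamp (T s : R) : R := Num.min T (Num.max 0 s).

Lemma clamp_itv (T s : R) : 0 <= T -> 0 <= clamp T s <= T.
Proof. by move=> T0; rewrite /clamp le_min T0 le_max lexx ge_min lexx. Qed.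

Lemma clamp_id (T s : R) : 0 <= s <= T -> clamp T s = s.
Proof. by case/andP => s0 sT; rewrite /clamp max_r // min_r. Qed.

Lemma continuous_clamp (T : R) : continuous (clamp T).
Proof.
apply: (@continuous_minr R R (cst T) (fun s => Num.max 0 s)); first exact: cst_continuous.
move=> s; apply: (@continuous_max R R (cst 0) id); first exact: cst_continuous.
exact: cvg_id.
Qed.

Lemma jcont_clamp (T : R) (w : R -> 'rV[R]_d -> R) : 0 <= T ->
  {within [set p : R * 'rV[R]_d | 0 <= p.1 <= T], continuous (fun p => w p.1 p.2)} ->
  jcont (fun s x => w (clamp T s) x).
Proof.
move=> T0 /subspace_continuousP cw p.
pose k (p : R * 'rV[R]_d) := (clamp T p.1, p.2).
have ck : continuous k.
  apply: continuous_pair; last by move=> ?; exact: cvg_snd.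
  apply: (continuous_compR (f := fst)); last exact: continuous_clamp.
  by move=> ?; exact: cvg_fst.
have Dk q : [set p : R * 'rV[R]_d | 0 <= p.1 <= T] (k q) by exact: clamp_itv.
apply: (@cvg_comp _ _ _ k (fun p => w p.1 p.2) (nbhs p) _ _ _ (cw (k p) (Dk p))).
move=> U /= WU.
have := ck p _ WU; rewrite /nbhs /=.
by apply: filterS => q; apply; exact: Dk.
Qed.

Lemma within_time_continuous (T : R) (w : R -> 'rV[R]_d -> R) x : 0 <= T ->
  {within [set p : R * 'rV[R]_d | 0 <= p.1 <= T], continuous (fun p => w p.1 p.2)} ->
  {within `[0, T], continuous (w^~ x)}.
Proof.
move=> T0 cw; have jw := jcont_clamp T0 cw.
apply: (@subspace_eq_continuous _ _ _ (fun s => w (clamp T s) x)).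
  by move=> s; rewrite inE /= in_itv /= => sT; rewrite clamp_id.
apply: continuous_subspaceT.
apply: (continuous_compR (f := fun s => (s, x)) (g := fun p => w (clamp T p.1) p.2)) => //.
by apply: continuous_pair; [move=> s; exact: cvg_id|exact: cst_continuous].
Qed.

Lemma gradhB (h : R) phi psi x :
  gradh h (fun y => phi y - psi y) x = gradh h phi x - gradh h psi x.
Proof. by apply/rowP => i; rewrite !mxE -mulrBl; congr (_ / _); ring. Qed.

Lemma laphB (h : R) phi psi x :
  laph h (fun y => phi y - psi y) x = laph h phi x - laph h psi x.
Proof. by rewrite /laph -sumrB; apply: eq_bigr => i _; rewrite -mulrBl; congr (_ / _); ring. Qed.

Lemma dotv_gradhZ (h k : R) phi x F :
  dotv (gradh h (fun y => k * phi y) x) F = k * dotv (gradh h phi x) F.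
Proof. by rewrite /dotv mulr_sumr; apply: eq_bigr => i _; rewrite !mxE; ring. Qed.

Lemma laphZ (h k : R) phi x : laph h (fun y => k * phi y) x = k * laph h phi x.
Proof. by rewrite /laph mulr_sumr; apply: eq_bigr => i _; ring. Qed.

Lemma gradh_shift (h : R) phi x (z : 'rV[R]_d) :
  gradh h (fun y => phi (y + z)) x = gradh h phi (x + z).
Proof. by apply/rowP => i; rewrite !mxE -!addrA ![_ + z]addrC. Qed.

Lemma laph_shift (h : R) phi x (z : 'rV[R]_d) :
  laph h (fun y => phi (y + z)) x = laph h phi (x + z).
Proof. by rewrite /laph; apply: eq_bigr => i _; rewrite -!addrA ![_ + z]addrC. Qed.

(* This is where N >= |f| / 2 enters: it makes the scheme monotone. *)
Lemma scheme_monotone (N h S : R) phi x F :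
  0 < h -> enorm F <= 2 * N -> (forall y, phi y <= S) ->
  dotv (gradh h phi x) F + N * h * laph h phi x <= 2 * d%:R * N / h * (S - phi x).
Proof.
move=> h0 FN pS.
have -> : 2 * d%:R * N / h * (S - phi x) = \sum_(i < d) (2 * N / h * (S - phi x)).
  by rewrite sumr_const card_ord -[RHS]mulr_natl; ring.
rewrite /dotv /laph mulr_sumr -big_split; apply: ler_sum => i _; rewrite mxE /=.
set p := phi (x + _); set m := phi (x - _).
have hp : p <= S by exact: pS.
have hm : m <= S by exact: pS.
have Fi := le_trans (normr_coord_le_enorm F i) FN.
move: Fi; rewrite ler_norml => /andP[F1 F2].
set G := F 0 i in F1 F2 *.
have -> : (p - m) / (2 * h) * G + N * h * ((p - 2 * phi x + m) / h ^+ 2) =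
   ((2 * N + G) * (p - phi x) + (2 * N - G) * (m - phi x)) / (2 * h).
  by field; rewrite gt_eqF.
have -> : 2 * N / h * (S - phi x) = (4 * N * (S - phi x)) / (2 * h).
  by field; rewrite gt_eqF.
rewrite ler_wpM2r ?invr_ge0 ?mulr_ge0 ?(ltW h0) //.
have : 0 <= (2 * N + G) * (S - p) by rewrite mulr_ge0 // ?subr_ge0 //; lra.
have : 0 <= (2 * N - G) * (S - m) by rewrite mulr_ge0 // ?subr_ge0 //; lra.
lra.
Qed.

(** The comparison principle is applied to [w] and [- w] simultaneously, with the sign adjoined to
    the space variable. Terminal value and running cost each contribute [K], hence [2 K]. *)
Lemma linear_scheme_bound (T N h K : R) (w : R -> 'rV[R]_d -> R) :
  0 <= T -> 0 < h -> 0 <= N -> 0 <= K ->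
  {within [set p : R * 'rV[R]_d | 0 <= p.1 <= T], continuous (fun p => w p.1 p.2)} ->
  (exists M : R, forall t x, 0 <= t <= T -> `|w t x| <= M) ->
  (forall x, `|w T x| <= K) ->
  (forall t x, 0 < t < T -> exists cost F, [/\ `|cost| <= K, enorm F <= 2 * N &
     is_derive t 1 (w^~ x) (- cost - dotv (gradh h (w t) x) F - N * h * laph h (w t) x)]) ->
  forall t x, 0 <= t <= T -> `|w t x| <= 2 * K * expR T.
Proof.
move=> T0 h0 N0 K0 cw [M wM] wT eqw t x tT.
pose sg (b : bool) : R := if b then -1 else 1.
pose u s (p : bool * 'rV[R]_d) := sg p.1 * w s p.2.
have uabs s p : u s p <= `|w s p.2|.
  rewrite /u /sg; case: p.1; rewrite ?mulN1r ?mul1r ?ler_norm //.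
  by rewrite -normrN ler_norm.
have H : forall s p, 0 <= s <= T -> u s p <= (K + K) * expR ((0 + 1) * (T - s)).
  apply: (@semidiscrete_maximum_principle R _ T (2 * d%:R * N / h) K 0 K M) => //.
  - by rewrite !mulr_ge0 // invr_ge0 ltW.
  - by move=> s p sT; apply: le_trans (uabs s p) _; exact: wM.
  - move=> p s; apply: cvgM; first exact: cvg_cst.
    exact: (@within_time_continuous T w p.2 T0 cw s).
  - by move=> p; apply: le_trans (uabs T p) _; exact: wT.
  move=> s [b y] S sT S0 uS.
  have [cost [F [cK FN dw]]] := eqw s y sT.
  exists (sg b * (- cost - dotv (gradh h (w s) y) F - N * h * laph h (w s) y)).
    rewrite /u /=; apply: is_derive_eq; rewrite /GRing.scale /=; ring.
  have := @scheme_monotone N h S (fun y => sg b * w s y) y F h0 FN (fun y => uS (b, y)).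
  rewrite dotv_gradhZ laphZ mul0r addr0 /u /=.
  have : sg b * cost <= K.
    apply: le_trans cK; rewrite /sg; case: b {uS} => /=; rewrite ?mulN1r ?mul1r ?ler_norm //.
    by rewrite -normrN ler_norm.
  lra.
have e : (K + K) * expR ((0 + 1) * (T - t)) <= 2 * K * expR T.
  rewrite add0r mul1r (_ : K + K = 2 * K); last by ring.
  rewrite ler_wpM2l ?mulr_ge0 // ler_expR; case/andP: tT; lra.
rewrite ler_norml; apply/andP; split.
  by have := le_trans (H t (true, x) tT) e; rewrite /u /=; lra.
by have := le_trans (H t (false, x) tT) e; rewrite /u /=; lra.
Qed.

Lemma is_sol_derive (T N h : R) (q : 'rV[R]_d -> R)
    (FF : R -> 'rV[R]_d -> 'rV[R]_d -> R) (w : R -> 'rV[R]_d -> R) t x :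
  is_sol T N h q FF w -> 0 < t < T ->
  is_derive t 1 (w^~ x) (- FF t x (gradh h (w t) x) - N * h * laph h (w t) x).
Proof.
move=> [_ [_ [_ H]]] tT; have [dw e] := H t x tT.
apply: DeriveDef => //; rewrite -derive1E; move: e; lra.
Qed.

(** * The Hamiltonian and the bounds on [v^h] and its differences *)

Section HJB.
Variables (m : nat) (T N K L h : R) (A : set 'rV[R]_m)
  (c : R -> 'rV[R]_d -> 'rV[R]_m -> R) (f : R -> 'rV[R]_d -> 'rV[R]_m -> 'rV[R]_d)
  (q : 'rV[R]_d -> R) (alpha : R -> 'rV[R]_d -> 'rV[R]_d -> 'rV[R]_m).
Hypotheses (T0 : 0 <= T) (N0 : 0 <= N) (K0 : 0 <= K) (L0 : 0 <= L) (h0 : 0 < h).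
Hypothesis A1 : assumption_A1 T K L A c f q.
Hypothesis argmin : is_argmin T A c f alpha.
Hypothesis fN : forall t x a, 0 <= t <= T -> A a -> enorm (f t x a) <= 2 * N.

Lemma alpha_le t x p a : 0 <= t <= T -> A a ->
  c t x (alpha t x p) + dotv p (f t x (alpha t x p)) <= c t x a + dotv p (f t x a).
Proof.
move=> tT Aa; have [_ H] := @argmin t x p tT.
by have [->//|/H/ltW] := pselect (a = alpha t x p); exact.
Qed.

Lemma Ham_alpha t x p : 0 <= t <= T ->
  Ham A c f t x p = c t x (alpha t x p) + dotv p (f t x (alpha t x p)).
Proof.
move=> tT; have [Aa _] := @argmin t x p tT; apply/le_anti/andP; split.
  apply: ge_inf; last by exists (alpha t x p).
  by exists (c t x (alpha t x p) + dotv p (f t x (alpha t x p))) => _ [a Aa' <-]; exact: alpha_le.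
apply: lb_le_inf; first by eexists; exists (alpha t x p).
by move=> _ [a Aa' <-]; exact: alpha_le.
Qed.

(** The minimizer at [(x, p)] is an admissible competitor at [(x', p')]. Freezing it linearizes the
    difference of Hamiltonians into a transport term with drift [F], the form that [scheme_monotone]
    handles. *)
Lemma Ham_diff_le t x x' p p' : 0 <= t <= T ->
  exists2 F, enorm F <= 2 * N &
  Ham A c f t x' p' - Ham A c f t x p <=
    L * (1 + enorm p') * enorm (x' - x) + dotv (p' - p) F.
Proof.
move=> tT; have [Aa _] := @argmin t x p tT; set a := alpha t x p in Aa.
exists (f t x a); first exact: fN.
have [_ [_ [lip _]]] := A1.
have [lc lf] := lip t t x' x a a tT tT Aa Aa.
have a0 : enorm (a - a) = 0 by rewrite subrr /enorm /sqnorm big1 ?sqrtr0 // => i _; rewrite mxE expr0n.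
rewrite subrr normr0 add0r a0 addr0 in lc lf.
rewrite (Ham_alpha x p tT) -/a (Ham_alpha x' p' tT).
have := @alpha_le t x' p' a tT Aa.
move: lc; rewrite ler_norml => /andP[_ lc].
have := le_trans (dotv_le p' (f t x' a - f t x a)) (ler_wpM2l (enorm_ge0 p') lf).
rewrite dotvBl dotvBr.
have -> : L * (1 + enorm p') * enorm (x' - x) =
  L * enorm (x' - x) + enorm p' * (L * enorm (x' - x)) by ring.
lra.
Qed.

Variable vh : R -> 'rV[R]_d -> R.
Hypothesis solh : is_sol T N h q (Ham A c f) vh.

Lemma vh_bound t x : 0 <= t <= T -> `|vh t x| <= 2 * K * expR T.
Proof.
have [cw [bw [wT _]]] := solh; have [cK [qK _]] := A1.
move: t x; apply: (linear_scheme_bound T0 h0 N0 K0 cw bw) => [x|t x tT].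
  by rewrite wT.
have tT' : 0 <= t <= T by case/andP: tT => /ltW -> /ltW ->.
set p := gradh h (vh t) x.
have [Aa _] := @argmin t x p tT'.
exists (c t x (alpha t x p)), (f t x (alpha t x p)); split.
- by have [] := cK t x _ tT' Aa.
- exact: fN.
have := is_sol_derive x solh tT; rewrite (Ham_alpha _ _ tT').
by congr is_derive; rewrite -/p; ring.
Qed.

(** The index [(b, i, y)] runs over all forward differences and their opposites, so a common bound
    [S] on [u] controls them all and hence the gradient, by [d S / h]. The dependence of the
    Hamiltonian on [x] then costs at most [L h + d L S], which is the affine growth in [S] that the
    comparison principle tolerates. *)
Lemma vh_difference_bound t x i : 0 <= t <= T ->
  `|vh t (x + h *: evec R i) - vh t x| <= 2 * L * h * expR ((d%:R * L + 1) * T).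
Proof.
move=> tT; have [cw [[M bw] [wT _]]] := solh; have [_ [_ [_ ql]]] := A1.
pose X : Type := ((bool * 'I_d) * 'rV[R]_d)%type.
pose d1 (b : bool) (i : 'I_d) : 'rV[R]_d := if b then h *: evec R i else 0.
pose u s (p : X) := vh s (p.2 + d1 p.1.1 p.1.2) - vh s (p.2 + d1 (~~ p.1.1) p.1.2).
have dd b j y : enorm (y + d1 b j - (y + d1 (~~ b) j)) = h.
  rewrite opprD addrACA subrr add0r /d1; case: b => /=.
    by rewrite subr0 enorm_scale_evec gtr0_norm.
  by rewrite sub0r enormN enorm_scale_evec gtr0_norm.
have H : forall s p, 0 <= s <= T -> u s p <= (L * h + L * h) * expR ((d%:R * L + 1) * (T - s)).
  apply: (@semidiscrete_maximum_principle R X T (2 * d%:R * N / h) (L * h) (d%:R * L) (L * h) (M + M)).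
  - by rewrite !mulr_ge0 // invr_ge0 ltW.
  - by rewrite mulr_ge0 // ltW.
  - by rewrite mulr_ge0.
  - by rewrite mulr_ge0 // ltW.
  - move=> s p sT; apply: le_trans (ler_norm _) _; apply: le_trans (ler_normB _ _) _.
    by apply: lerD; exact: bw.
  - by move=> p s; apply: cvgB; exact: (@within_time_continuous T vh _ T0 cw s).
  - move=> [[b j] y]; rewrite /u !wT; apply: le_trans (ler_norm _) _.
    by apply: le_trans (ql _ _) _; rewrite dd.
  move=> s [[b j] y] S sT S0 uS.
  have sT' : 0 <= s <= T by case/andP: sT => /ltW -> /ltW ->.
  set x' := y + d1 b j; set x1 := y + d1 (~~ b) j.
  set p' := gradh h (vh s) x'; set p := gradh h (vh s) x1.
  have Dle z k : `|vh s (z + h *: evec R k) - vh s z| <= S.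
    have := uS ((true, k), z); have := uS ((false, k), z).
    by rewrite /u /d1 /= !addr0 ler_norml; move=> h1 h2; apply/andP; split; lra.
  have p'le : enorm p' <= d%:R * (S / h).
    apply: enorm_le_coords => k; rewrite mxE normrM normfV (gtr0_norm (mulr_gt0 _ h0)) //.
    rewrite ler_pdivrMr ?mulr_gt0 // (_ : S / h * (2 * h) = S + S); last by field; rewrite gt_eqF.
    have -> : vh s (x' + h *: evec R k) - vh s (x' - h *: evec R k) =
      (vh s (x' + h *: evec R k) - vh s x') +
      (vh s (x' - h *: evec R k + h *: evec R k) - vh s (x' - h *: evec R k)) by rewrite subrK; ring.
    by apply: le_trans (ler_normD _ _) _; apply: lerD; exact: Dle.
  have [F FN HF] := @Ham_diff_le s x1 x' p p' sT'.
  have e1 := is_sol_derive x' solh sT; have e2 := is_sol_derive x1 solh sT.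
  exists ((- Ham A c f s x' p' - N * h * laph h (vh s) x') -
     (- Ham A c f s x1 p - N * h * laph h (vh s) x1)).
    by rewrite /u /=; exact: is_deriveB.
  have := @scheme_monotone N h S (fun z => u s ((b, j), z)) y F h0 FN (fun z => uS ((b, j), z)).
  rewrite /u /= gradhB laphB !gradh_shift !laph_shift -/x' -/x1 -/p -/p'.
  rewrite dd in HF.
  have : L * (1 + enorm p') * h <= L * h + d%:R * L * S.
    have -> : L * h + d%:R * L * S = L * (1 + d%:R * (S / h)) * h by field; rewrite gt_eqF.
    by rewrite ler_wpM2r ?(ltW h0) // ler_wpM2l // lerD2l.
  lra.
have e : (L * h + L * h) * expR ((d%:R * L + 1) * (T - t)) <= 2 * L * h * expR ((d%:R * L + 1) * T).
  rewrite (_ : L * h + L * h = 2 * L * h); last by ring.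
  rewrite ler_wpM2l ?mulr_ge0 ?(ltW h0) // ler_expR ler_wpM2l ?addr_ge0 ?mulr_ge0 //.
  by case/andP: tT; lra.
have := le_trans (H t ((true, i), x) tT) e; have := le_trans (H t ((false, i), x) tT) e.
by rewrite /u /d1 /= !addr0 ler_norml => h1 h2; apply/andP; split; lra.
Qed.

Lemma gradh_vh_bound t x : 0 <= t <= T ->
  enorm (gradh h (vh t) x) <= d%:R * (2 * L * expR ((d%:R * L + 1) * T)).
Proof.
move=> tT; apply: enorm_le_coords => k.
rewrite mxE normrM normfV (gtr0_norm (mulr_gt0 _ h0)) // ler_pdivrMr ?mulr_gt0 //.
set B := 2 * L * h * expR ((d%:R * L + 1) * T).
have -> : 2 * L * expR ((d%:R * L + 1) * T) * (2 * h) = B + B by rewrite /B; ring.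
have -> : vh t (x + h *: evec R k) - vh t (x - h *: evec R k) =
   (vh t (x + h *: evec R k) - vh t x) +
   (vh t (x - h *: evec R k + h *: evec R k) - vh t (x - h *: evec R k)) by rewrite subrK; ring.
by apply: le_trans (ler_normD _ _) _; apply: lerD; exact: vh_difference_bound.
Qed.

(** The real [sup] dominates a set only if the set is bounded above, so the explicit gradient bound
    already enters the first estimate. *)
Lemma gradh_le_supgrad t x : 0 <= t <= T -> enorm (gradh h (vh t) x) <= supgrad T h vh.
Proof.
move=> tT; apply: ub_le_sup; last by exists (t, x).
exists (d%:R * (2 * L * expR ((d%:R * L + 1) * T))) => _ [[s y] /= sT <-].
exact: gradh_vh_bound.
Qed.

Lemma supgrad_le : supgrad T h vh <= d%:R * (2 * L * expR ((d%:R * L + 1) * T)).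
Proof.
apply: sup_le_ub => [|_ [[s y] /= sT <-]]; last exact: gradh_vh_bound.
by exists (enorm (gradh h (vh 0) 0)); exists (0, 0) => //=; rewrite lexx.
Qed.

Lemma supgrad_ge0 : 0 <= supgrad T h vh.
Proof. by apply: le_trans (enorm_ge0 _) (@gradh_le_supgrad 0 0 _); rewrite lexx. Qed.

(** * The pointwise energy inequality for the error of one policy update *)

Lemma gradh_coordE (e : R) phi x (i : 'I_d) :
  gradh e phi x 0 i =
  ((phi (x + e *: evec R i) - phi x) + (phi x - phi (x - e *: evec R i))) / (2 * e).
Proof. by rewrite mxE; congr (_ / _); ring. Qed.

Lemma sqnorm_gradh_le (e : R) phi x : 0 < e ->
  sqnorm (gradh e phi x) <= sqdiff e phi x / (2 * e ^+ 2).
Proof.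
move=> e0; rewrite /sqnorm /sqdiff mulr_suml; apply: ler_sum => i _.
rewrite gradh_coordE; set a := phi (x + _) - _; set b := _ - phi (x - _).
have -> : ((a + b) / (2 * e)) ^+ 2 = ((a + b) ^+ 2 / 2) / (2 * e ^+ 2).
  by field; rewrite gt_eqF.
rewrite ler_wpM2r ?invr_ge0 ?mulr_ge0 ?(ltW e0) //.
have := sqr_ge0 (a - b); lra.
Qed.

(* Young's inequality absorbs the transport term into the discrete diffusion and the
   policy error [g] into a small multiple of the previous iterate's differences. *)
Lemma energy_pointwise (G C g : R) (w u : 'rV[R]_d -> R) x F :
  0 <= G -> 14 * d%:R * N + 20 * L ^+ 4 <= C -> enorm F <= 2 * N ->
  `|g| <= L ^+ 2 * (1 + G) * enorm (gradh h u x) ->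
  N / h * (3 / 4 * sqdiff h w x - sqneighbours h w x + 8 * d%:R * w x ^+ 2)
    - sqdiff h u x / (20 * h) <=
  C * (1 + G ^+ 2) / h * w x ^+ 2 +
    2 * w x * (- dotv (gradh h w x) F - N * h * laph h w x - g).
Proof.
move=> G0 CC FN gle.
have h0' : h != 0 by rewrite gt_eqF.
(* The identity for [2 w Lap^h w] yields [sqdiff] with coefficient [1] and [w^2] with [2 d]. Young's
   inequality on the transport term, with [|F_i| <= 2 N], takes [1/4] and [8 d] away, leaving [3/4]
   and [- 6 d]. *)
have transport : N / h * (3 / 4 * sqdiff h w x - sqneighbours h w x - 6 * d%:R * w x ^+ 2) <=
    2 * w x * (- dotv (gradh h w x) F - N * h * laph h w x).
  have -> : N / h * (3 / 4 * sqdiff h w x - sqneighbours h w x - 6 * d%:R * w x ^+ 2) =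
     \sum_(i < d) N / h * (3 / 4 * ((w (x + h *: evec R i) - w x) ^+ 2 +
       (w x - w (x - h *: evec R i)) ^+ 2) - (w (x + h *: evec R i) ^+ 2 +
        w (x - h *: evec R i) ^+ 2) - 6 * w x ^+ 2).
    rewrite /sqdiff /sqneighbours -mulr_sumr !sumrB -mulr_sumr sumr_const card_ord.
    by congr (_ * (_ - _)); rewrite -[RHS]mulr_natl; ring.
  have -> : 2 * w x * (- dotv (gradh h w x) F - N * h * laph h w x) =
    \sum_(i < d) 2 * w x * (- (gradh h w x 0 i * F 0 i) -
      N * h * ((w (x + h *: evec R i) - 2 * w x + w (x - h *: evec R i)) / h ^+ 2)).
    by rewrite -mulr_sumr sumrB sumrN -mulr_sumr.
  apply: ler_sum => i _; rewrite mxE.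
  set p := w (x + _); set m' := w (x - _).
  have := le_trans (normr_coord_le_enorm F i) FN.
  rewrite ler_norml; set Fi := F 0 i => /andP[F1 F2].
  rewrite -subr_ge0.
  have -> : 2 * w x * (- ((p - m') / (2 * h) * Fi) - N * h * ((p - 2 * w x + m') / h ^+ 2)) -
     N / h * (3 / 4 * ((p - w x) ^+ 2 + (w x - m') ^+ 2) - (p ^+ 2 + m' ^+ 2) - 6 * w x ^+ 2) =
     (N * (((p - w x) ^+ 2 + (w x - m') ^+ 2) / 4 + 8 * w x ^+ 2) - w x * (p - m') * Fi) / h.
    by field.
  rewrite divr_ge0 ?(ltW h0) // subr_ge0.
  have y1 : 2 * (w x * (p - m')) <= ((p - w x) ^+ 2 + (w x - m') ^+ 2) / 4 + 8 * w x ^+ 2.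
    have := sqr_ge0 ((p - w x) / 2 - 2 * w x); have := sqr_ge0 ((w x - m') / 2 - 2 * w x); lra.
  have y2 : - (2 * (w x * (p - m'))) <= ((p - w x) ^+ 2 + (w x - m') ^+ 2) / 4 + 8 * w x ^+ 2.
    have := sqr_ge0 ((p - w x) / 2 + 2 * w x); have := sqr_ge0 ((w x - m') / 2 + 2 * w x); lra.
  set Y := (_ / 4 + _) in y1 y2 *; set X := w x * (p - m') in y1 y2 *.
  have [X0|X0] := leP 0 X.
    have : X * Fi <= X * (2 * N) by rewrite ler_wpM2l.
    have : N * (2 * X) <= N * Y by rewrite ler_wpM2l.
    lra.
  have : X * Fi <= X * (- (2 * N)) by rewrite ler_wnM2l // ltW.
  have : N * (- (2 * X)) <= N * Y by rewrite ler_wpM2l.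
  lra.
(* Young with weights [h / 10] and [10 / h]: since [E^2 <= sqdiff / (2 h^2)], the first gives
   [1 / (20 h)]; since [(1 + G)^2 <= 2 (1 + G^2)], the second gives [20 L^4]. *)
have source : - sqdiff h u x / (20 * h) - 20 * L ^+ 4 * (1 + G ^+ 2) / h * w x ^+ 2 <=
    - (2 * w x * g).
  set E := enorm (gradh h u x) in gle.
  have E2 : E ^+ 2 <= sqdiff h u x / (2 * h ^+ 2) by rewrite enorm_sqr sqnorm_gradh_le.
  pose M := L ^+ 2 * (1 + G).
  have M0 : 0 <= M by rewrite mulr_ge0 ?sqr_ge0 // addr_ge0.
  have wg : 2 * w x * g <= 2 * (`|w x| * (M * E)).
    rewrite -mulrA ler_wpM2l //; apply: le_trans (ler_norm _) _.
    by rewrite normrM ler_wpM2l.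
  have young : 2 * (`|w x| * (M * E)) <= h / 10 * E ^+ 2 + 10 / h * (M ^+ 2 * w x ^+ 2).
    rewrite -subr_ge0 -(real_normK (num_real (w x))).
    have -> : h / 10 * E ^+ 2 + 10 / h * (M ^+ 2 * `|w x| ^+ 2) - 2 * (`|w x| * (M * E)) =
       (h * E - 10 * (M * `|w x|)) ^+ 2 / (10 * h) by field.
    by rewrite divr_ge0 ?sqr_ge0 // mulr_ge0 // ltW.
  have s1 : h / 10 * E ^+ 2 <= sqdiff h u x / (20 * h).
    have -> : sqdiff h u x / (20 * h) = h / 10 * (sqdiff h u x / (2 * h ^+ 2)) by field.
    by rewrite ler_wpM2l // divr_ge0 // ltW.
  have s2 : 10 / h * (M ^+ 2 * w x ^+ 2) <= 20 * L ^+ 4 * (1 + G ^+ 2) / h * w x ^+ 2.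
    rewrite -subr_ge0.
    have -> : 20 * L ^+ 4 * (1 + G ^+ 2) / h * w x ^+ 2 - 10 / h * (M ^+ 2 * w x ^+ 2) =
       10 / h * ((L ^+ 2) ^+ 2 * (1 - G) ^+ 2 * w x ^+ 2) by rewrite /M; field.
    rewrite mulr_ge0 ?divr_ge0 ?(ltW h0) //.
    by rewrite mulr_ge0 ?sqr_ge0 // mulr_ge0 ?sqr_ge0.
  rewrite mulNr; lra.
(* [14 = 6 + 8]: the coefficient [- 6 d] left by the transport step is raised to the [8 d] that
   [energy_inequality] expects. *)
have growth : N / h * (14 * d%:R * w x ^+ 2) + 20 * L ^+ 4 * (1 + G ^+ 2) / h * w x ^+ 2 <=
    C * (1 + G ^+ 2) / h * w x ^+ 2.
  have -> : N / h * (14 * d%:R * w x ^+ 2) + 20 * L ^+ 4 * (1 + G ^+ 2) / h * w x ^+ 2 =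
    (14 * d%:R * N + 20 * L ^+ 4 * (1 + G ^+ 2)) / h * w x ^+ 2 by field.
  rewrite ler_wpM2r ?sqr_ge0 // ler_wpM2r ?invr_ge0 ?(ltW h0) //.
  have G2 : 1 <= 1 + G ^+ 2 by rewrite lerDl sqr_ge0.
  apply: le_trans (_ : (14 * d%:R * N + 20 * L ^+ 4) * (1 + G ^+ 2) <= _); last first.
    by rewrite ler_wpM2r // (le_trans ler01).
  have : 14 * d%:R * N <= 14 * d%:R * N * (1 + G ^+ 2) by rewrite ler_peMr // !mulr_ge0.
  lra.
move: transport source growth; rewrite mulNr.
set X := 2 * w x * (- dotv _ _ - _).
have -> : 2 * w x * (- dotv (gradh h w x) F - N * h * laph h w x - g) = X - 2 * w x * g.
  by rewrite /X; ring.
have -> : N / h * (3 / 4 * sqdiff h w x - sqneighbours h w x - 6 * d%:R * w x ^+ 2) =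
  N / h * (3 / 4 * sqdiff h w x - sqneighbours h w x + 8 * d%:R * w x ^+ 2) -
  N / h * (14 * d%:R * w x ^+ 2) by field.
lra.
Qed.

Variable alpha0 : R -> 'rV[R]_d -> 'rV[R]_m.
Variable v : nat -> R -> 'rV[R]_d -> R.
Hypothesis A2 : assumption_A2 T L A alpha alpha0.
Hypothesis solv : forall n, is_sol T N h q (lin_term c f (policy h alpha alpha0 v n)) (v n).

Lemma v0_bound t x : 0 <= t <= T -> `|v 0 t x| <= 2 * K * expR T.
Proof.
have [cw [bw [wT _]]] := solv 0; have [cK [qK _]] := A1; have [_ [Aa _]] := A2.
move: t x; apply: (linear_scheme_bound T0 h0 N0 K0 cw bw) => [x|t x tT].
  by rewrite wT.
have tT' : 0 <= t <= T by case/andP: tT => /ltW -> /ltW ->.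
exists (c t x (alpha0 t x)), (f t x (alpha0 t x)); split.
- by have [] := cK t x _ tT' (Aa t x).
- exact: fN.
have := is_sol_derive x (solv 0) tT; rewrite /lin_term /=.
by congr is_derive; ring.
Qed.

(** Splitting the gradient of [v_(n+1)] as [p] plus the gradient of the error separates the
    transport of the error from the loss [g], which is evaluated at [p]. The factor [L^2] in the
    bound on [g] comes from two Lipschitz estimates: from gradients to controls through [alpha],
    then from controls to [c] and [f]. *)
Lemma policy_error_energy n C t x : 0 < t < T -> 14 * d%:R * N + 20 * L ^+ 4 <= C ->
  exists2 dw, is_derive t 1 (fun s => v n.+1 s x - vh s x) dw &
  N / h * (3 / 4 * sqdiff h (fun y => v n.+1 t y - vh t y) x
           - sqneighbours h (fun y => v n.+1 t y - vh t y) x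
           + 8 * d%:R * (v n.+1 t x - vh t x) ^+ 2)
    - sqdiff h (fun y => v n t y - vh t y) x / (20 * h) <=
  C * (1 + supgrad T h vh ^+ 2) / h * (v n.+1 t x - vh t x) ^+ 2 +
    2 * (v n.+1 t x - vh t x) * dw.
Proof.
move=> tT CC; have tT' : 0 <= t <= T by case/andP: tT => /ltW -> /ltW ->.
set p := gradh h (vh t) x.
set an := alpha t x (gradh h (v n t) x); set ah := alpha t x p.
set F := f t x an.
pose g := c t x an + dotv p F - Ham A c f t x p.
exists (- dotv (gradh h (fun y => v n.+1 t y - vh t y) x) F
   - N * h * laph h (fun y => v n.+1 t y - vh t y) x - g).
  have e1 := is_sol_derive x (solv n.+1) tT; have e2 := is_sol_derive x solh tT.
  have := is_deriveB e1 e2; congr is_derive.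
  rewrite gradhB laphB dotvBl /lin_term /= /g -/an -/F -/p; ring.
have [Aan _] := @argmin t x (gradh h (v n t) x) tT'.
have [Aah _] := @argmin t x p tT'.
apply: (@energy_pointwise _ C g (fun y => v n.+1 t y - vh t y)
  (fun y => v n t y - vh t y)) => //; first exact: supgrad_ge0.
  exact: fN.
have [_ [_ [lip _]]] := A1; have [lipa _] := A2.
have [lc lf] := lip t t x x an ah tT' tT' Aan Aah.
have e0 k : enorm (0 : 'rV[R]_k) = 0.
  by rewrite /enorm /sqnorm big1 ?sqrtr0 // => i _; rewrite mxE expr0n.
have la := lipa t t x x (gradh h (v n t) x) p tT' tT'.
rewrite !subrr normr0 e0 !add0r -/an -/ah in lc lf la.
rewrite gradhB -/p; set E := enorm (gradh h (v n t) x - p) in la *.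
rewrite /g (Ham_alpha x p tT') -/ah.
have -> : c t x an + dotv p F - (c t x ah + dotv p (f t x ah)) =
  (c t x an - c t x ah) + dotv p (F - f t x ah) by rewrite dotvBr; ring.
apply: le_trans (ler_normD _ _) _.
have pG : enorm p <= supgrad T h vh by exact: gradh_le_supgrad.
have la' : L * enorm (an - ah) <= L ^+ 2 * E.
  by rewrite expr2 -mulrA ler_wpM2l.
have d1 : `|dotv p (F - f t x ah)| <= supgrad T h vh * (L ^+ 2 * E).
  apply: le_trans (normr_dotv_le _ _) _.
  apply: ler_pM => //; rewrite ?enorm_ge0 //.
  exact: le_trans lf la'.
have := le_trans lc la'.
have -> : L ^+ 2 * (1 + supgrad T h vh) * E = L ^+ 2 * E + supgrad T h vh * (L ^+ 2 * E) by ring.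
lra.
Qed.

(** * Geometric decay of the energies and the first bound *)

Hypotheses (d0 : (0 < d)%N) (N1 : 1 <= N) (h1 : h < 1).

Definition werr n s x : R := v n (clamp T s) x - vh (clamp T s) x.

Lemma werrE n s : 0 <= s <= T -> werr n s = (fun x => v n s x - vh s x).
Proof. by move=> sT; apply/funext => x; rewrite /werr clamp_id. Qed.

Lemma jcont_werr n : jcont (werr n).
Proof.
have [cw _] := solh; have [cv _] := solv n.
by apply: jcont_sub; exact: jcont_clamp.
Qed.

Lemma policy_iteration_step n C t r : 14 * d%:R * N + 20 * L ^+ 4 <= C ->
  0 <= t -> t < T -> 1 <= r ->
  let lam := C * (1 + supgrad T h vh ^+ 2) / h in
  let S k := stint t T (fun s x => expR (lam * (s - t)) * sqdiff h (werr k s) x * weight r x) in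
  ((int_Rd (fun x => (werr n.+1 t x ^+ 2 * weight r x)%:E) +
   (3 / 4 * (N / h))%:E * S n.+1 <= (1 / (20 * h))%:E * S n)%E : Prop).
Proof.
move=> CC t0 tT r1 lam S.
have [_ [[M1 vM1] [vT _]]] := solv n.+1; have [_ [[M2 vM2] [vhT _]]] := solh.
apply: (@energy_inequality R d (werr n.+1) (werr n) t T lam h N (M1 + M2) r) => //.
- by rewrite h0.
- rewrite /lam divr_ge0 ?(ltW h0) // mulr_ge0 ?addr_ge0 ?sqr_ge0 //.
  apply: le_trans CC; rewrite addr_ge0 // mulr_ge0 ?exprn_ge0 // mulr_ge0 //.
- exact: jcont_werr.
- exact: jcont_werr.
- move=> s x; apply: le_trans (ler_normB _ _) _.
  by apply: lerD; [apply: vM1|apply: vM2]; exact: clamp_itv.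
- by move=> x; rewrite /werr clamp_id ?T0 ?lexx // vT vhT subrr.
move=> s x /andP[ts sT].
have sT' : 0 < s < T by rewrite sT (le_lt_trans t0 ts).
have sT2 : 0 <= s <= T by case/andP: sT' => /ltW -> /ltW ->.
have [dw d1 d2] := @policy_error_energy n C s x sT' CC.
exists dw; last by rewrite !(werrE _ sT2).
have /andP[s0 s1] := sT'.
(* Near an interior time [clamp] is the identity, so the derivative is unchanged. *)
apply: near_eq_is_derive d1.
near=> u; rewrite /werr clamp_id //.
have u0 : 0 < u by near: u; exact: (lt_nbhsr s0).
have uT : u < T by near: u; exact: (lt_nbhsl s1).
by rewrite !ltW.
Unshelve. all: by end_near. Qed.

Lemma int_ball_le_weight n t r : 0 <= t <= T ->
  (int_Rd (fun x => (\1_(ballR r) x * (v n t x - vh t x) ^+ 2)%:E) <=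
   int_Rd (fun x => (werr n t x ^+ 2 * weight r x)%:E))%E.
Proof.
move=> tT; apply: le_int_Rd => x; first by rewrite lee_fin mulr_ge0 ?sqr_ge0.
rewrite (werrE _ tT) lee_fin indicE.
have [|_] := boolP (x \in ballR r); last by rewrite mul0r mulr_ge0 ?sqr_ge0 ?weight_ge0.
by rewrite inE => xr; rewrite mul1r weight_ball // mulr1.
Qed.

Lemma local_error_estimate n C t r : 14 * d%:R * N + 20 * L ^+ 4 <= C ->
  0 <= t <= T -> 1 <= r ->
  (int_Rd (fun x => (\1_(ballR r) x * (v n.+1 t x - vh t x) ^+ 2)%:E) <=
   (h / 2 ^+ n.+2)%:E *
   stint t T (fun s x => (expR (C * (1 + supgrad T h vh ^+ 2) * (s - t) / h)
             * sqnorm (fwdh h (fun y => v 0%N s y - vh s y) x)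
             * Num.min 1 (expR (- enorm x + r + 1)))%R))%E.
Proof.
move=> CC tT r1; apply: le_trans (int_ball_le_weight _ _ tT) _.
set I := stint _ _ _.
have I0 : (0 <= I)%E.
  apply: stint_ge0 => s x.
  by rewrite (mulr_ge0 _ (weight_ge0 r x)) // mulr_ge0 ?expR_ge0 ?sqnorm_ge0.
have /andP[t0 tT'] := tT.
(* At [t = T] both solutions equal [q] and the left side vanishes; the energy inequality requires
   [t < T]. *)
move: tT'; rewrite le_eqVlt => /predU1P[tE|tT'].
  have [_ [_ [vT _]]] := solv n.+1; have [_ [_ [vhT _]]] := solh.
  apply: (@le_trans _ _ 0%E); last by rewrite mule_ge0 // lee_fin divr_ge0 ?exprn_ge0 ?(ltW h0).
  have -> : (fun x => (werr n.+1 t x ^+ 2 * weight r x)%:E) = (fun=> 0%E).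
    by apply/funext => x; rewrite (werrE _ tT) tE vT vhT subrr expr0n /= mul0r.
  elim: (d) => [//|k IH] /=.
  by rewrite integral0_eq // => y _; apply/le_anti; rewrite IH int_Rd_ge0.
set lam := C * (1 + supgrad T h vh ^+ 2) / h.
pose S k := stint t T (fun s x => expR (lam * (s - t)) * sqdiff h (werr k s) x * weight r x).
have step k := @policy_iteration_step k C t r CC t0 tT' r1.
have S0 k : (0 <= S k)%E.
  apply: stint_ge0 => s x; rewrite mulr_ge0 ?mulr_ge0 ?expR_ge0 ?sqdiff_ge0 //.
  exact: weight_ge0.
have E0 k : (0 <= int_Rd (fun x => (werr k t x ^+ 2 * weight r x)%:E))%E.
  by apply: int_Rd_ge0 => x; rewrite lee_fin mulr_ge0 ?sqr_ge0 ?weight_ge0.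
(* The quotient of [1 / (20 h)] by [3 N / (4 h)] is [1 / (15 N)], below [1/2] because [N >= 1]. *)
have Shalf k : (S k.+1 <= (2^-1)%:E * S k)%E.
  have c0 : 0 < 3 / 4 * (N / h) by rewrite mulr_gt0 // divr_gt0 // (lt_le_trans ltr01).
  have : ((3 / 4 * (N / h))%:E * S k.+1 <= (1 / (20 * h))%:E * S k)%E.
    by apply: le_trans (step k); rewrite -/lam -/(S k.+1) leeDr.
  rewrite -(lee_pdivlMl _ _ c0) => /le_trans; apply.
  rewrite muleA -EFinM; apply: lee_wpmul2r => //.
  rewrite lee_fin ler_pdivrMl // div1r -[leRHS]mulrA.
  rewrite -subr_ge0.
  have -> : 3 / 4 * (N / h * 2^-1) - (20 * h)^-1 = (15 * N - 2) / (40 * h).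
    by field; rewrite gt_eqF.
  apply: divr_ge0; last by rewrite mulr_ge0 // ltW.
  by move: N1; lra.
have Spow k : (S k <= (2 ^- k)%:E * S 0%N)%E.
  elim: k => [|k IH]; first by rewrite expr0 invr1 mul1e.
  apply: le_trans (Shalf k) _.
  rewrite exprS invfM EFinM -muleA; apply: lee_wpmul2l; last exact: IH.
  by rewrite lee_fin invr_ge0.
have S0le : (S 0%N <= (5 * h ^+ 2)%:E * I)%E.
  have h01 : 0 < h < 1 by rewrite h0.
  have ce : continuous (fun s => expR (lam * (s - t))).
    apply: (continuous_compR (f := fun s => lam * (s - t))); last exact: continuous_expR.
    apply: continuous_mulr; first exact: cst_continuous.
    by apply: continuous_subr; [move=> s; exact: cvg_id|exact: cst_continuous].
  apply: le_trans (@stint_sqdiff_le R d t T r h _ _ h01 ce (fun s => expR_ge0 _) (@jcont_werr 0)) _.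
  apply: lee_wpmul2l; first by rewrite lee_fin mulr_ge0 ?sqr_ge0.
  rewrite le_eqVlt; apply/orP; left; apply/eqP; apply: eq_stint => s x /andP[ts sT].
  rewrite (werrE 0) ?sT ?(le_trans t0 ts) //.
  by congr (expR _ * _ * _); rewrite /lam mulrAC.
(* The factors multiply to [(1 / (20 h)) 2^(-n) 5 h^2 = h / 2^(n+2)], the required one for the
   iterate [n + 1]. *)
apply: (@le_trans _ _ ((1 / (20 * h))%:E * S n)%E).
  apply: le_trans (step n); rewrite -/lam -/(S n.+1) leeDl // mule_ge0 // lee_fin.
  by rewrite mulr_ge0 // divr_ge0 // ltW.
have c20 : 0 <= 1 / (20 * h) by rewrite divr_ge0 // mulr_ge0 // ltW.
apply: (@le_trans _ _ ((1 / (20 * h))%:E * ((2 ^- n)%:E * ((5 * h ^+ 2)%:E * I)))%E).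
  apply: lee_wpmul2l; first by rewrite lee_fin.
  apply: le_trans (Spow n) _; apply: lee_wpmul2l; last exact: S0le.
  by rewrite lee_fin invr_ge0 exprn_ge0.
rewrite !muleA -!EFinM; apply: lee_wpmul2r => //; rewrite lee_fin !exprS.
have y0 : 2 ^+ n != 0 :> R by rewrite expf_neq0 // pnatr_eq0.
by rewrite le_eqVlt; apply/orP; left; apply/eqP; field; rewrite y0 gt_eqF.
Qed.

(** * The second bound and its explicit constant *)

(** Four values are involved, each at most [2 K exp T]; they are simply added and divided by [h]. *)
Lemma sqnorm_fwdh_error_le s x : 0 <= s <= T ->
  sqnorm (fwdh h (fun y => v 0%N s y - vh s y) x) <= d%:R * (8 * K * expR T / h) ^+ 2.
Proof.
move=> sT.
have -> : d%:R * (8 * K * expR T / h) ^+ 2 = \sum_(i < d) (8 * K * expR T / h) ^+ 2.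
  by rewrite sumr_const card_ord -[RHS]mulr_natl.
apply: ler_sum => i _; rewrite mxE -[leLHS]real_normK ?num_real //.
rewrite lerXn2r ?nnegrE ?divr_ge0 ?mulr_ge0 ?expR_ge0 ?(ltW h0) //.
rewrite normrM normfV (gtr0_norm h0) ler_wpM2r ?invr_ge0 ?(ltW h0) //.
have b1 y := v0_bound y sT; have b2 y := vh_bound y sT.
have -> : 8 * K * expR T = (2 * K * expR T + 2 * K * expR T) + (2 * K * expR T + 2 * K * expR T) by ring.
apply: le_trans (ler_normB _ _) _; apply: lerD; apply: le_trans (ler_normB _ _) _; exact: lerD.
Qed.

(** One constant must serve as prefactor, as coefficient of the outer exponent and as rate in [T].
    These need, respectively, the last summand, the first two summands and [2 d L + 3]; being
    nonnegative, they are added. *)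
Definition final_const : R :=
  (14 * d%:R * N + 20 * L ^+ 4) * (1 + 4 * d%:R ^+ 2 * L ^+ 2) + 2 + (2 * d%:R * L + 3)
  + 32 * d%:R * K ^+ 2 * weight_const R d ^+ d.

(** Both [exp (3 T)] and [1 / h] are at most [exp (exp (3 T) / h)], which explains the [2] added to
    the coefficient. The rate [2 d L + 3] is twice the rate [d L + 1] of the gradient bound, plus
    [1] for [T <= exp T]. *)
Lemma exponent_bound (C : R) : 0 <= C ->
  expR (C * (1 + supgrad T h vh ^+ 2) * T / h) * (expR (3 * T) / h) <=
  expR ((C * (1 + 4 * d%:R ^+ 2 * L ^+ 2) + 2) * expR ((2 * d%:R * L + 3) * T) / h).
Proof.
move=> C0.
have G0 : 0 <= supgrad T h vh by exact: supgrad_ge0.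
have Gle : supgrad T h vh <= d%:R * (2 * L * expR ((d%:R * L + 1) * T)) by exact: supgrad_le.
set e3 := expR (3 * T); set e2 := expR ((2 * d%:R * L + 3) * T).
have e3ge1 : 1 <= e3 by rewrite -expR0 ler_expR mulr_ge0.
have e3e2 : e3 <= e2.
  by rewrite ler_expR ler_wpM2r // lerDr !mulr_ge0.
have hV : 0 <= h^-1 by rewrite invr_ge0 ltW.
have a1 : e3 <= expR (e3 / h).
  apply: le_trans (_ : expR (3 * T) <= _) => //; rewrite ler_expR.
  apply: le_trans (_ : 1 + 3 * T <= _); first by rewrite lerDr.
  apply: le_trans (expR_ge1Dx _) _; rewrite -/e3 ler_peMr ?(le_trans ler01) //.
  by rewrite invf_ge1 // ltW.
have a2 : h^-1 <= expR (e3 / h).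
  apply: le_trans (_ : 1 + h^-1 <= _); first by rewrite lerDr.
  apply: le_trans (expR_ge1Dx _) _; rewrite ler_expR ler_peMl //.
have a3 : e3 / h <= expR (2 * e2 / h).
  apply: le_trans (_ : expR (e3 / h) * expR (e3 / h) <= _).
    by apply: ler_pM => //; exact: expR_ge0.
  rewrite -expRD ler_expR -mulrDl ler_wpM2r //.
  lra.
have a4 : C * (1 + supgrad T h vh ^+ 2) * T <= C * (1 + 4 * d%:R ^+ 2 * L ^+ 2) * e2.
  set ee := expR ((d%:R * L + 1) * T) in Gle.
  have ee1 : 1 <= ee by rewrite -expR0 ler_expR mulr_ge0 // addr_ge0 // mulr_ge0.
  have g2 : 1 + supgrad T h vh ^+ 2 <= (1 + 4 * d%:R ^+ 2 * L ^+ 2) * ee ^+ 2.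
    have : supgrad T h vh ^+ 2 <= (d%:R * (2 * L * ee)) ^+ 2.
      by rewrite lerXn2r // nnegrE // !mulr_ge0 // expR_ge0.
    have -> : (d%:R * (2 * L * ee)) ^+ 2 = 4 * d%:R ^+ 2 * L ^+ 2 * ee ^+ 2 by ring.
    have : 1 <= ee ^+ 2 by rewrite exprn_ege1.
    lra.
  have Te : T <= expR T by apply: le_trans (expR_ge1Dx _); rewrite lerDr.
  have -> : C * (1 + 4 * d%:R ^+ 2 * L ^+ 2) * e2 =
     C * ((1 + 4 * d%:R ^+ 2 * L ^+ 2) * ee ^+ 2) * expR T.
    have -> : e2 = ee ^+ 2 * expR T by rewrite /e2 /ee expr2 -!expRD; congr expR; ring.
    ring.
  apply: ler_pM => //; last by rewrite ler_wpM2l.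
  by rewrite mulr_ge0 // addr_ge0 // sqr_ge0.
apply: (@le_trans _ _ (expR (C * (1 + 4 * d%:R ^+ 2 * L ^+ 2) * e2 / h) * expR (2 * e2 / h))).
  apply: ler_pM; [exact: expR_ge0| |by rewrite ler_expR ler_wpM2r|exact: a3].
  by rewrite mulr_ge0 // expR_ge0.
by rewrite -expRD ler_expR -mulrDl -mulrDl.
Qed.

Lemma uniform_error_estimate n t r : 0 <= t <= T -> 1 <= r ->
  (int_Rd (fun x => (\1_(ballR r) x * (v n.+1 t x - vh t x) ^+ 2)%:E) <=
   (final_const / 2 ^+ n.+1 * expR (final_const * expR (final_const * T) / h) * r ^+ d)%:E)%E.
Proof.
move=> tT r1; have /andP[t0 tT'] := tT.
set C0 := 14 * d%:R * N + 20 * L ^+ 4.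
have C00 : 0 <= C0 by rewrite addr_ge0 // mulr_ge0 ?exprn_ge0 // mulr_ge0.
apply: le_trans (local_error_estimate (C := C0) n (lexx _) tT r1) _.
set G := supgrad T h vh.
set kap := (weight_const R d * r) ^+ d.
pose M := expR (C0 * (1 + G ^+ 2) * T / h) * (d%:R * (8 * K * expR T / h) ^+ 2).
have M0 : 0 <= M by rewrite mulr_ge0 ?expR_ge0 // mulr_ge0 ?sqr_ge0.
have kap0 : 0 <= kap by rewrite exprn_ge0 // mulr_ge0 ?weight_const_ge0 // (le_trans ler01).
have sb : (stint t T (fun s x => (expR (C0 * (1 + G ^+ 2) * (s - t) / h)
             * sqnorm (fwdh h (fun y => v 0%N s y - vh s y) x) * weight r x)%R) <=
          (M * (T - t) * kap)%:E)%E.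
  apply: stint_weight_le => //.
    by move=> s x; rewrite mulr_ge0 ?expR_ge0 ?sqnorm_ge0.
  move=> s x /andP[ts sT]; apply: ler_pM; rewrite ?expR_ge0 ?sqnorm_ge0 //.
    have CG : 0 <= C0 * (1 + G ^+ 2) by rewrite mulr_ge0 // addr_ge0 // sqr_ge0.
    rewrite ler_expR ler_wpM2r ?invr_ge0 ?(ltW h0) // ler_wpM2l //.
    lra.
  by apply: sqnorm_fwdh_error_le; rewrite sT (le_trans t0 ts).
apply: le_trans (lee_wpmul2l _ sb) _; first by rewrite lee_fin divr_ge0 ?exprn_ge0 ?(ltW h0).
rewrite -EFinM lee_fin.
have Te : T - t <= expR T by apply: le_trans (expR_ge1Dx _); lra.
(* [h / 2^(n+2)] times [64 d K^2 exp (2 T) / h^2] leaves [32 d K^2]; the third factor [exp T] in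
   [exp (3 T)] bounds [T - t]. *)
pose D := 32 * d%:R * K ^+ 2 * weight_const R d ^+ d.
have D0 : 0 <= D by rewrite mulr_ge0 ?exprn_ge0 ?weight_const_ge0 // mulr_ge0 ?sqr_ge0 // mulr_ge0.
pose X := expR (C0 * (1 + G ^+ 2) * T / h) * (expR (3 * T) / h).
apply: le_trans (_ : D / 2 ^+ n.+1 * X * r ^+ d <= _).
  have -> : D / 2 ^+ n.+1 * X * r ^+ d = h / 2 ^+ n.+2 * (M * expR T * kap).
    rewrite /D /X /M /kap [(weight_const R d * r) ^+ d]exprMn (_ : expR (3 * T) = expR T ^+ 3); last first.
      by rewrite -expRM_natl.
    have y0 : 2 ^+ n.+1 != 0 :> R by rewrite expf_neq0 // pnatr_eq0.
    rewrite (exprS 2 n.+1); move: (2 ^+ n.+1) y0 => y y0.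
    by field; rewrite y0 gt_eqF.
  rewrite ler_wpM2l ?divr_ge0 ?exprn_ge0 ?(ltW h0) // ler_wpM2r // ler_wpM2l //.
have r0 : 0 <= r ^+ d by rewrite exprn_ge0 // (le_trans ler01).
have p1 : 0 <= C0 * (1 + 4 * d%:R ^+ 2 * L ^+ 2).
  by rewrite mulr_ge0 // addr_ge0 // !mulr_ge0 ?sqr_ge0.
have p2 : 0 <= 2 * d%:R * L by rewrite !mulr_ge0.
have fE : final_const = C0 * (1 + 4 * d%:R ^+ 2 * L ^+ 2) + 2 + (2 * d%:R * L + 3) + D by [].
have f0 : 0 <= final_const by rewrite fE; lra.
rewrite ler_wpM2r //; apply: ler_pM.
- by rewrite divr_ge0 ?exprn_ge0.
- by rewrite mulr_ge0 ?divr_ge0 ?expR_ge0 ?(ltW h0).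
- by rewrite ler_wpM2r ?invr_ge0 ?exprn_ge0 // fE; lra.
apply: le_trans (exponent_bound C00) _.
rewrite ler_expR ler_wpM2r ?invr_ge0 ?(ltW h0) //; apply: ler_pM; rewrite ?expR_ge0 //.
- lra.
- by rewrite fE; lra.
by rewrite ler_expR ler_wpM2r // fE; lra.
Qed.

End HJB.
End Scheme.

(** * Choice of the universal constant *)

Unset Implicit Arguments.
Set Strict Implicit.

Theorem theorem3p1 (R : realType) (d : nat) (N K L : R) :
  (0 < d)%N -> 1 <= N ->
  exists C : R, 0 < C /\
  forall (m : nat) (T : R) (A : set 'rV[R]_m)
    (c : R -> 'rV[R]_d -> 'rV[R]_m -> R)
    (f : R -> 'rV[R]_d -> 'rV[R]_m -> 'rV[R]_d)
    (q : 'rV[R]_d -> R)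
    (alpha : R -> 'rV[R]_d -> 'rV[R]_d -> 'rV[R]_m)
    (alpha0 : R -> 'rV[R]_d -> 'rV[R]_m)
    (h : R) (v : nat -> R -> 'rV[R]_d -> R) (vh : R -> 'rV[R]_d -> R),
    (0 < m)%N -> 1 <= T -> compact A ->
    assumption_A1 T K L A c f q ->
    is_argmin T A c f alpha ->
    assumption_A2 T L A alpha alpha0 ->
    {within [set p : R * 'rV[R]_d | 0 <= p.1 <= T],
       continuous (fun p => alpha0 p.1 p.2)} ->
    0 < h < 1 ->
    (forall t x a, 0 <= t <= T -> A a -> enorm (f t x a) <= 2 * N) ->
    (forall n, is_sol T N h q (lin_term c f (policy h alpha alpha0 v n)) (v n)) ->
    is_sol T N h q (Ham A c f) vh ->
    forall (n : nat) (r t : R), (1 <= n)%N -> 1 <= r -> 0 <= t <= T ->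
      (int_Rd (fun x => (\1_(ballR r) x * (v n t x - vh t x) ^+ 2)%:E) <=
       (h / 2 ^+ n.+1)%:E *
       \int[@lebesgue_measure R]_(s in `[t%R, T%R])
          int_Rd (fun x =>
            (expR (C * (1 + supgrad T h vh ^+ 2) * (s - t) / h)
             * sqnorm (fwdh h (fun y => v 0%N s y - vh s y) x)
             * Num.min 1 (expR (- enorm x + r + 1)))%:E))%E /\
      (ereal_sup [set int_Rd (fun x => (\1_(ballR r) x * (v n s x - vh s x) ^+ 2)%:E)
                  | s in `[0%R, T%R]]
       <= (C / 2 ^+ n * expR (C * expR (C * T) / h) * r ^+ d)%:E)%E.
Proof.
move=> d0 N1; have N0 : 0 <= N := le_trans ler01 N1.
(* The constant has to be given before (A1) is available to make [K] and [L] nonnegative. If one of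
   them is negative, (A1) fails, by its bounds on [q] at the origin and between the origin and a
   unit vector, so any positive constant will do. *)
have [[K0 L0]|KL] := pselect (0 <= K /\ 0 <= L); last first.
  exists 1; split => // m T A c f q alpha alpha0 h v vh _ _ _ [_ [qK [_ qL]]].
  exfalso; apply: KL; split; first exact: le_trans (normr_ge0 _) (qK 0).
  have := le_trans (normr_ge0 _) (qL (1 *: evec R (Ordinal d0)) 0).
  by rewrite subr0 enorm_scale_evec normr1 mulr1.
have c1 : 0 <= 14 * d%:R * N + 20 * L ^+ 4.
  by rewrite addr_ge0 // mulr_ge0 ?exprn_ge0 // mulr_ge0.
have c2 : 0 <= 4 * d%:R ^+ 2 * L ^+ 2 by rewrite !mulr_ge0 ?sqr_ge0.
have c3 : 0 <= (14 * d%:R * N + 20 * L ^+ 4) * (4 * d%:R ^+ 2 * L ^+ 2) by rewrite mulr_ge0.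
have c4 : 0 <= 2 * d%:R * L by rewrite !mulr_ge0.
have c5 : 0 <= 32 * d%:R * K ^+ 2 * weight_const R d ^+ d.
  by rewrite mulr_ge0 ?exprn_ge0 ?weight_const_ge0 // mulr_ge0 ?sqr_ge0 // mulr_ge0.
have CE : final_const d N K L = 14 * d%:R * N + 20 * L ^+ 4 +
   (14 * d%:R * N + 20 * L ^+ 4) * (4 * d%:R ^+ 2 * L ^+ 2) + 2 * d%:R * L + 5 +
   32 * d%:R * K ^+ 2 * weight_const R d ^+ d by rewrite /final_const; ring.
exists (final_const d N K L); split; first by rewrite CE; lra.
move=> m T A c f q alpha alpha0 h v vh _ T1 _ A1 argmin A2 _ /andP[h0 h1] fN solv solh.
move=> [//|n] r t _ r1 tT.
have T0 : 0 <= T := le_trans ler01 T1.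
split.
  apply: (local_error_estimate T0 N0 L0 h0 A1 argmin fN solh A2 solv) => //.
  by rewrite CE; lra.
apply: ge_ereal_sup => _ [s /= + <-]; rewrite in_itv /= => sT.
exact: (uniform_error_estimate T0 N0 K0 L0 h0 A1 argmin fN solh A2 solv).
Qed.
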